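(* Let $F=\alpha^{1-m}\beta^m$ ($m\neq0,1$ a constant) be an $m$-Kropina metric on an $n$-dimensional manifold $M$, and let $V$ be a conformal vector field of $F$. Suppose that either $F$ is a Landsberg metric and $n\ge 3$, or $F$ is a Douglas metric and $m\neq -1$. Then $V$ is homothetic.
   Context: Manifolds are assumed connected. Here $\alpha=\sqrt{a_{ij}(x)y^iy^j}$ is a positive definite Riemannian metric and $\beta=b_i(x)y^i$ is a nowhere vanishing 1-form on $M$; $F$ is a singular Finsler metric, considered on the open conic part of $TM\setminus 0$ where it is defined and positive (e.g. $\beta>0$). Conformal and homothetic vector fields: for $V=V^i\partial/\partial x^i$ let $V^c:=V^i\frac{\partial}{\partial x^i}+y^i\frac{\partial V^j}{\partial x^i}\frac{\partial}{\partial y^j}$ be its complete lift to $TM$ (the superscript $c$ is only notation). $V$ is a conformal vector field of $F$ with conformal factor $c=c(x)$ if $V^c(F)=2cF$ (equivalently, the lifted flow $\widetilde\varphi_t$ of $V$ satisfies $\widetilde\varphi_t^*F=e^{2\sigma_t}F$ with $\sigma_t$ functions on $M$, $c=\frac{d}{dt}|_{t=0}\sigma_t$). $V$ is homothetic if it is conformal with constant conformal factor $c$. Let $g_{ij}=\frac12[F^2]_{y^iy^j}$ and let $G^i=\frac14 g^{il}\{[F^2]_{x^ky^l}y^k-[F^2]_{x^l}\}$ be the spray coefficients of $F$. $F$ is a Landsberg metric if its Landsberg curvature $L_{jkl}=-\frac12 F F_{y^i}[G^i]_{y^jy^ky^l}$ vanishes. $F$ is a Douglas metric if $G^iy^j-G^jy^i$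 are homogeneous polynomials of degree three in $y$; equivalently, locally $G^i=\frac12\Gamma^i_{jk}(x)y^jy^k+P(x,y)y^i$.
   Formalization: The dimension is assumed to be n ≥ 2, also in the Douglas case: for n = 1 the claim fails, since with M = ℝ, α = |y|, β = y the metric F = y is Douglas and every V = f(x)∂/∂x is conformal with factor f′/2, which need not be constant. *)

(* Defs.v *)
From HB Require Import structures.
From mathcomp Require Import all_boot all_order all_algebra.
From mathcomp Require Import all_classical all_reals all_analysis.

Set Implicit Arguments.
Unset Strict Implicit.
Unset Printing Implicit Defensive.

Import Order.TTheory GRing.Theory Num.Theory.
Import numFieldNormedType.Exports.
Local Open Scope classical_set_scope.
Local Open Scope ring_scope.

Section Euclidean.
Context {R : realType} {n : nat}.
Local Notation E := 'rV[R]_n.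

Definition partial (i : 'I_n) (f : E -> R) : E -> R :=
  fun x => 'D_(delta_mx 0 i) f x.

(* C^oo on the (open) set U: all iterated partial derivatives exist on U and
   are continuous there. *)
Definition smooth_on (U : set E) (f : E -> R) : Prop :=
  forall (s : seq 'I_n) (x : E), U x ->
    {for x, continuous (foldr partial f s)} /\
    (forall i, derivable (foldr partial f s) x (delta_mx 0 i)).

(* Partial derivatives of a function of (x, y), x the position and y the
   fibre coordinate. *)
Definition delx (i : 'I_n) (L : E -> E -> R) : E -> E -> R :=
  fun x y => partial i (fun z => L z y) x.

Definition dely (i : 'I_n) (L : E -> E -> R) : E -> E -> R :=
  fun x => partial i (L x).

(* V^c(L) = V^i L_{x^i} + y^i (d V^j / d x^i) L_{y^j} *)
Definition complete_lift (V : E -> E) (L : E -> E -> R) (x y : E) : R :=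
  \sum_i V x 0 i * delx i L x y +
  \sum_i \sum_j y 0 i * partial i (fun z => V z 0 j) x * dely j L x y.

Definition sqr_fun (F : E -> E -> R) : E -> E -> R := fun x y => F x y ^+ 2.

Definition fund_tensor (F : E -> E -> R) (x y : E) : 'M[R]_n :=
  \matrix_(i, j) (2^-1 * dely j (dely i (sqr_fun F)) x y).

Definition spray (F : E -> E -> R) (i : 'I_n) (x y : E) : R :=
  4^-1 * \sum_l invmx (fund_tensor F x y) i l *
    (\sum_k dely l (delx k (sqr_fun F)) x y * y 0 k - delx l (sqr_fun F) x y).

Definition landsberg_curvature (F : E -> E -> R) (j k l : 'I_n) (x y : E) : R :=
  - 2^-1 * F x y *
    \sum_i dely i F x y * dely l (dely k (dely j (spray F i))) x y.

End Euclidean.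

(* Connected smooth n-dimensional manifolds. The charts form an atlas that
   need not be maximal; chart_map i and chart_inv i are only meaningful on
   chart_dom i and on its image. *)
Record manifold (R : realType) (n : nat) := Manifold {
  carrier :> topologicalType ;
  chart : Type ;
  chart_dom : chart -> set carrier ;
  chart_map : chart -> carrier -> 'rV[R]_n ;
  chart_inv : chart -> 'rV[R]_n -> carrier ;
  manifold_hausdorff : hausdorff_space carrier ;
  manifold_second_countable : @second_countable carrier ;
  manifold_connected : connected [set: carrier] ;
  chart_cover : forall p, exists i, chart_dom i p ;
  chart_dom_open : forall i, open (chart_dom i) ;
  chart_cod_open : forall i, open (chart_map i @` chart_dom i) ;
  chart_mapK : forall i p, chart_dom i p -> chart_inv i (chart_map i p) = p ;
  chart_map_continuous : forall i,
    {within chart_dom i, continuous (chart_map i)} ;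
  chart_inv_continuous : forall i,
    {within chart_map i @` chart_dom i, continuous (chart_inv i)} ;
  chart_transition_smooth : forall i j (k : 'I_n),
    smooth_on (chart_map i @` (chart_dom i `&` chart_dom j))
              (fun x => chart_map j (chart_inv i x) 0 k)
}.

Section Manifold.
Context {R : realType} {n : nat} (M : manifold R n).
Local Notation E := 'rV[R]_n.

Definition chart_cod (i : chart M) : set E := chart_map i @` chart_dom i.

Definition overlap (i j : chart M) : set E :=
  chart_map i @` (chart_dom i `&` chart_dom j).

Definition transition (i j : chart M) : E -> E :=
  fun x => chart_map j (chart_inv i x).

(* Tensor fields are given by their components in every chart. In the
   transformation laws, ('J f x) k l is the derivative of the l-th component
   of f in the k-th direction: jacobians act on row vectors on the right. *)
Record vector_field := VectorField {
  vf_coord :> chart M -> E -> E ;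
  vf_smooth : forall i k, smooth_on (chart_cod i) (fun x => vf_coord i x 0 k) ;
  vf_change : forall i j x, overlap i j x ->
    vf_coord j (transition i j x) =
    vf_coord i x *m 'J (transition i j) x
}.

Record one_form := OneForm {
  of_coord :> chart M -> E -> E ;
  of_smooth : forall i k, smooth_on (chart_cod i) (fun x => of_coord i x 0 k) ;
  of_change : forall i j x, overlap i j x ->
    of_coord i x =
    of_coord j (transition i j x) *m ('J (transition i j) x)^T
}.

Record riemannian_metric := RiemannianMetric {
  rm_coord :> chart M -> E -> 'M[R]_n ;
  rm_smooth : forall i k l,
    smooth_on (chart_cod i) (fun x => rm_coord i x k l) ;
  rm_sym : forall i x, chart_cod i x -> (rm_coord i x)^T = rm_coord i x ;
  rm_posdef : forall i x, chart_cod i x -> forall y : E, y != 0 ->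
    0 < \sum_k \sum_l rm_coord i x k l * y 0 k * y 0 l ;
  rm_change : forall i j x, overlap i j x ->
    rm_coord i x =
    'J (transition i j) x *m rm_coord j (transition i j x)
      *m ('J (transition i j) x)^T
}.

Definition nowhere_vanishing (b : one_form) : Prop :=
  forall i x, chart_cod i x -> b i x != 0.

(* A function on a conic subset of TM, in the induced coordinates (x, y);
   its values outside the cone are irrelevant. *)
Record cone_function := ConeFunction {
  cone : chart M -> E -> set E ;
  cone_val :> chart M -> E -> E -> R
}.

Definition conformal_with_factor (F : cone_function) (V : vector_field)
    (c : M -> R) : Prop :=
  forall i x, chart_cod i x -> forall y, cone F i x y ->
    complete_lift (V i) (F i) x y = 2 * c (chart_inv i x) * F i x y.

Definition conformal (F : cone_function) (V : vector_field) : Prop :=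
  exists c : M -> R, conformal_with_factor F V c.

Definition homothetic (F : cone_function) (V : vector_field) : Prop :=
  exists c : R, conformal_with_factor F V (fun=> c).

(* The fundamental tensor of a singular metric may degenerate inside its cone
   (it does for alpha^(1-m) beta^m with m > 0), and the spray coefficients make
   sense only where it does not. *)
Definition regular_cone (F : cone_function) (i : chart M) (x : E) : set E :=
  cone F i x `&` [set y | \det (fund_tensor (F i) x y) != 0].

Definition landsberg (F : cone_function) : Prop :=
  forall i x, chart_cod i x -> forall y, regular_cone F i x y ->
    forall j k l, landsberg_curvature (F i) j k l x y = 0.

Definition douglas (F : cone_function) : Prop :=
  forall i x, chart_cod i x -> forall j k : 'I_n,
    exists T : 'I_n -> 'I_n -> 'I_n -> R, forall y, regular_cone F i x y ->
      spray (F i) j x y * y 0 k - spray (F i) k x y * y 0 j =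
      \sum_p \sum_q \sum_r T p q r * y 0 p * y 0 q * y 0 r.

Definition alpha (a : riemannian_metric) (i : chart M) (x y : E) : R :=
  Num.sqrt (\sum_k \sum_l a i x k l * y 0 k * y 0 l).

Definition beta (b : one_form) (i : chart M) (x y : E) : R :=
  \sum_k b i x 0 k * y 0 k.

(* Real powers are meaningful for positive bases only, whence the cone. *)
Definition kropina (m : R) (a : riemannian_metric) (b : one_form) :
    cone_function :=
  {| cone := fun i x => [set y | 0 < beta b i x y] ;
     cone_val := fun i x y =>
       (alpha a i x y) `^ (1 - m) * (beta b i x y) `^ m |}.

End Manifold.

(* Main.v *)
Require Import Defs.
From mathcomp Require Import all_boot all_order all_algebra.
From mathcomp Require Import all_classical all_reals all_analysis.
From mathcomp Require Import ring lra.

Set Implicit Arguments.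
Unset Strict Implicit.
Unset Printing Implicit Defensive.

Import Order.TTheory GRing.Theory Num.Theory.
Import numFieldNormedType.Exports.
Local Open Scope classical_set_scope.
Local Open Scope ring_scope.

(** The idea of the proof. Let N be the squared length of beta for alpha. Replacing
    alpha^2 by N^m alpha^2 and beta by N^((m-1)/2) beta does not change
    F = alpha^(1-m) beta^m, so beta may be taken of unit length; let W be its dual
    vector field, so that the metric a satisfies a(W, -) = beta and a(W, W) = 1.

    A direction y splits as u W + w with beta(w) = 0, and on the line u |-> u W + w
    everything is explicit. Contracting the equations of the spray G with W and w
    gives a linear 2 x 2 system for beta(G) and a(w, G), whose determinant vanishes
    only where m |w|^2 = u^2; its solution is a quadratic polynomial in u, the
    contribution of the Levi-Civita connection of a, plus a rational function of u
    with denominator m |w|^2 - u^2 whose coefficients are rho, half of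
    (L_W a)(w, w), and sigma, half of (d beta)(w, W) (lemma spray_line). If F is
    Landsberg, the third derivative along the line of a fixed combination of the two
    components vanishes; if F is Douglas, |w|^2 beta(G) - u a(w, G) is a cubic
    polynomial in u. Either condition kills the fraction, hence rho and sigma
    (landsberg_line and douglas_line; for m = -1 the fraction in the Douglas
    combination cancels, which is why that case is excluded). Since beta has unit
    length, (L_W a)(W, W) = 0 and (L_W a)(W, w) = -2 sigma, so that W is a Killing
    field of a (dual_killing).

    On the other side, conformality of V with factor c is, for each x, a polynomial
    identity in y that amounts to L_V a = 4 c a and L_V beta = 2 c beta
    (conformal_forms), whence [V, W] = -2 c W (bracket_dual). Then
    L_[V,W] a = L_V L_W a - L_W L_V a becomes
    -2 (dc (x) beta + beta (x) dc) = -4 (W c) a, because L_W a = 0. On a nonzero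
    vector orthogonal to W the left side vanishes, so W c = 0, and then dc = 0
    (conformal_factor_gradient). So c is locally constant, and it is constant because
    the manifold is connected. *)

(** * Calculus on open subsets of R^n *)

Section DirectionalDerivative.
Context {R : realType} {E : normedModType R}.
Implicit Types (f g : E -> R) (x v : E).

(** Transfers the chain rule and the mean value theorem of one real variable to
    directional derivatives. *)
Lemma is_derive_line f x v (s d : R) :
  is_derive (s *: v + x) v f d <->
  is_derive s 1 (fun h : R => f (h *: v + x)) d.
Proof.
have eqg : (fun h : R => h^-1 *: ((f \o shift (s *: v + x)) (h *: v)
    - f (s *: v + x))) =
  (fun h : R => h^-1 *: (((fun h : R => f (h *: v + x)) \o shift s) (h *: 1)
    - f (s *: v + x))).
  by apply/funext => h /=; rewrite [h *: 1]mulr1 scalerDl addrA.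
by split=> -[df dE]; split; move: df dE; rewrite /derivable /derive eqg.
Qed.

Lemma is_derive_translate f z x v (d : R) :
  is_derive (z + x) v f d -> is_derive x v (fun x => f (z + x)) d.
Proof.
move=> [df dE]; split; move: df dE; rewrite /derivable /derive.
  by under eq_fun do rewrite /= addrCA.
by under eq_fun do rewrite /= addrCA.
Qed.

Lemma is_derive_comp1 f (g : R -> R) x v (df dg : R) :
  is_derive (f x) 1 g dg -> is_derive x v f df ->
  is_derive x v (fun z => g (f z)) (dg * df).
Proof.
move=> Hg; have -> : x = 0 *: v + x by rewrite scale0r add0r.
move=> /is_derive_line Hf; apply/is_derive_line.
apply: (@is_derive1_comp _ g (fun h : R => f (h *: v + x))) => //.
by rewrite scale0r add0r.
Qed.

Lemma is_derive_powR f x v (p df : R) : 0 < f x -> is_derive x v f df ->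
  is_derive x v (fun z => f z `^ p) (p * f x `^ (p - 1) * df).
Proof.
by move=> fx; apply: (@is_derive_comp1 f (fun t => t `^ p)); exact: is_derive1_powR.
Qed.

Lemma is_derive_inv f x v (df : R) : f x != 0 -> is_derive x v f df ->
  is_derive x v (fun z => (f z)^-1) (- (f x) ^- 2 * df).
Proof.
by move=> fx [H <-]; split; [exact: derivableV|rewrite deriveV].
Qed.

Lemma is_derive_add f g x v (df dg : R) :
  is_derive x v f df -> is_derive x v g dg ->
  is_derive x v (fun z => f z + g z) (df + dg).
Proof. by move=> ? ?; exact: is_deriveD. Qed.

Lemma is_derive_mul f g x v (df dg : R) :
  is_derive x v f df -> is_derive x v g dg ->
  is_derive x v (fun z => f z * g z) (df * g x + f x * dg).
Proof.
move=> Hf Hg; have := @is_deriveM _ _ f g x v df dg Hf Hg.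
by move=> H; apply: is_derive_eq H _; rewrite addrC [g x *: _]mulrC.
Qed.

Lemma is_derive_const (c : R) x v : is_derive x v (fun=> c) 0.
Proof. exact: is_derive_cst. Qed.

Lemma is_derive_bigsum (I : Type) (s : seq I) (P : pred I) (h : I -> E -> R)
    (dh : I -> R) x v :
  (forall i, P i -> is_derive x v (h i) (dh i)) ->
  is_derive x v (fun z => \sum_(i <- s | P i) h i z) (\sum_(i <- s | P i) dh i).
Proof.
move=> H; elim: s => [|i s IH].
  under eq_fun do rewrite big_nil.
  by rewrite big_nil; exact: is_derive_const.
under eq_fun do rewrite big_cons.
rewrite big_cons; case: ifP => // Pi.
by apply: is_derive_add => //; exact: H.
Qed.

Lemma is_derive_div (f g : E -> R) x v (df dg : R) : g x != 0 ->
  is_derive x v f df -> is_derive x v g dg ->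
  is_derive x v (fun z => f z / g z) (df / g x - f x * dg / g x ^+ 2).
Proof.
move=> g0 Hf Hg; have := is_derive_mul Hf (is_derive_inv g0 Hg).
by move=> H; apply: is_derive_eq H _; ring.
Qed.

Lemma is_derive_scale (c : R) (f : E -> R) x v (df : R) :
  is_derive x v f df -> is_derive x v (fun z => c * f z) (c * df).
Proof.
move=> Hf; have := is_derive_mul (is_derive_const c x v) Hf.
by move=> H; apply: is_derive_eq H _; rewrite mul0r add0r.
Qed.

End DirectionalDerivative.

Section Calculus.
Context {R : realType} {n : nat}.
Local Notation E := 'rV[R]_n.
Implicit Types (f g : E -> R) (U : set E) (x v : E) (k : nat).

Lemma is_derive_coord x v (j : 'I_n) : is_derive x v (fun z : E => z 0 j) (v 0 j).
Proof.
have -> : x = 0 *: v + x by rewrite scale0r add0r.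
apply/is_derive_line.
under eq_fun do rewrite !mxE.
have := @is_deriveD _ _ _ (fun h : R => h * v 0 j) (cst (x 0 j)) 0 1 (v 0 j) 0.
rewrite addr0; apply.
have H := is_deriveM (is_derive_id (0 : R) 1) (is_derive_cst (v 0 j) (0 : R) 1).
by apply: is_derive_eq H _; rewrite scaler0 add0r [_ *: _]mulr1.
Qed.

Lemma partialE i f x (d : R) :
  is_derive x (delta_mx 0 i) f d -> partial i f x = d.
Proof. by move=> H; rewrite /partial derive_val. Qed.

Lemma eq_open_is_derive U f g x v (d : R) : open U -> U x -> {in U, f =1 g} ->
  is_derive x v f d -> is_derive x v g d.
Proof.
move=> oU Ux fg; apply: near_eq_is_derive.
have : nbhs x U by apply: open_nbhs_nbhs; split.
by apply: filterS => z Uz; apply: fg; rewrite inE.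
Qed.

Lemma eq_open_partial U f g : open U -> {in U, f =1 g} ->
  forall i, {in U, partial i f =1 partial i g}.
Proof.
move=> oU fg i x; rewrite inE => Ux; apply: near_eq_derive.
have : nbhs x U by apply: open_nbhs_nbhs; split.
by apply: filterS => z Uz; apply: fg; rewrite inE.
Qed.

(** * The classes C^k *)

(** The class C^k by recursion on k, with partial derivatives only: the closure
    properties below are inductions that replace a function by its partial
    derivatives. *)
Fixpoint Cn k U f : Prop :=
  (forall x, U x -> {for x, continuous f}) /\
  if k is k'.+1 then
    (forall i x, U x -> derivable f x (delta_mx 0 i)) /\
    (forall i, Cn k' U (partial i f))
  else True.

Lemma CnW k U f : Cn k.+1 U f -> Cn k U f.
Proof.
elim: k f => [|k IH] f; first by case.
by move=> [cf [df pf]]; split=> //; split=> // i; apply: IH.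
Qed.

Lemma Cn_cont k U f : Cn k U f -> forall x, U x -> {for x, continuous f}.
Proof. by case: k => [|k] []. Qed.

Lemma Cn_derivable k U f x i : Cn k.+1 U f -> U x ->
  is_derive x (delta_mx 0 i) f (partial i f x).
Proof. by move=> [_ [df _]] Ux; split=> //; exact: df. Qed.

Lemma Cn_partial k U f i : Cn k.+1 U f -> Cn k U (partial i f).
Proof. by move=> [_ [_ H]]; exact: H. Qed.

Lemma smooth_on_Cn k U f : smooth_on U f -> Cn k U f.
Proof.
elim: k f => [|k IH] f sf; first by split=> // x /(sf [::])[].
split; first by move=> x /(sf [::])[].
split=> [i x Ux|i]; first by have [_] := sf [::] x Ux; apply.
by apply: IH => s x Ux; have := sf (rcons s i) x Ux; rewrite foldr_rcons.
Qed.

Lemma Cn_subset k U U' f : U `<=` U' -> Cn k U' f -> Cn k U f.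
Proof.
move=> UU'; elim: k f => [|k IH] f [cf H].
  by split=> // x /UU'; exact: cf.
case: H => df pf; split; first by move=> x /UU'; exact: cf.
by split=> [i x /UU'|i]; [exact: df|exact: IH (pf i)].
Qed.

Lemma eq_open_continuous U f g x : open U -> U x -> {in U, f =1 g} ->
  {for x, continuous f} -> {for x, continuous g}.
Proof.
move=> oU Ux fg cf; rewrite /prop_for /continuous_at -(fg x) ?inE//.
apply: cvg_trans cf; apply: (@near_eq_cvg _ _ (nbhs x)).
have : nbhs x U by apply: open_nbhs_nbhs; split.
by apply: filterS => z Uz; apply: fg; rewrite inE.
Qed.

Lemma eq_open_Cn k U f g : open U -> {in U, f =1 g} -> Cn k U f -> Cn k U g.
Proof.
move=> oU; elim: k f g => [|k IH] f g fg [cf H]; split=> //.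
- by move=> x Ux; exact: (eq_open_continuous oU Ux fg (cf x Ux)).
- by move=> x Ux; exact: (eq_open_continuous oU Ux fg (cf x Ux)).
case: H => df pf; split=> [i x Ux|i].
  by have [] := eq_open_is_derive oU Ux fg (derivableP (df i x Ux)).
by apply: IH (pf i); exact: eq_open_partial.
Qed.

Lemma Cn_const k U (c : R) : Cn k U (fun=> c).
Proof.
elim: k c => [|k IH] c; split=> //; do ?by [move=> x _; exact: cst_continuous].
split=> [i x _|i]; first exact: derivable_cst.
have -> : partial i (fun=> c) = fun=> 0.
  by apply/funext => x; apply: partialE; exact: is_derive_const.
exact: IH.
Qed.

Lemma Cn_add k U f g : open U -> Cn k U f -> Cn k U g ->
  Cn k U (fun z => f z + g z).
Proof.
move=> oU; elim: k f g => [|k IH] f g Hf Hg; split=> //.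
- by move=> x Ux; apply: (@continuousD _ _ _ f g);
    [exact: Cn_cont Hf _ _|exact: Cn_cont Hg _ _].
- by move=> x Ux; apply: (@continuousD _ _ _ f g);
    [exact: Cn_cont Hf _ _|exact: Cn_cont Hg _ _].
split=> [i x Ux|i].
  by have [] := is_derive_add (Cn_derivable i Hf Ux) (Cn_derivable i Hg Ux).
apply: (@eq_open_Cn _ _ (fun z => partial i f z + partial i g z)) => //.
  move=> x /[1!inE] Ux; apply/esym/partialE.
  exact: is_derive_add (Cn_derivable i Hf Ux) (Cn_derivable i Hg Ux).
by apply: IH; exact: Cn_partial.
Qed.

Lemma Cn_mul k U f g : open U -> Cn k U f -> Cn k U g ->
  Cn k U (fun z => f z * g z).
Proof.
move=> oU; elim: k f g => [|k IH] f g Hf Hg; split=> //.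
- by move=> x Ux; apply: (@continuousM _ _ f g);
    [exact: Cn_cont Hf _ _|exact: Cn_cont Hg _ _].
- by move=> x Ux; apply: (@continuousM _ _ f g);
    [exact: Cn_cont Hf _ _|exact: Cn_cont Hg _ _].
split=> [i x Ux|i].
  by have [] := is_derive_mul (Cn_derivable i Hf Ux) (Cn_derivable i Hg Ux).
apply: (@eq_open_Cn _ _
  (fun z => partial i f z * g z + f z * partial i g z)) => //.
  move=> x /[1!inE] Ux; apply/esym/partialE.
  exact: is_derive_mul (Cn_derivable i Hf Ux) (Cn_derivable i Hg Ux).
by apply: Cn_add => //; apply: IH; try exact: CnW; exact: Cn_partial.
Qed.

Lemma Cn_opp k U f : open U -> Cn k U f -> Cn k U (fun z => - f z).
Proof.
move=> oU Hf; have := Cn_mul oU (Cn_const k U (-1)) Hf.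
by apply: eq_open_Cn => // x _; rewrite mulN1r.
Qed.

Lemma Cn_powR k U f (p : R) : open U -> (forall x, U x -> 0 < f x) ->
  Cn k U f -> Cn k U (fun z => f z `^ p).
Proof.
move=> oU fpos; elim: k p => [|k IH] p Hf; split=> //.
- move=> x Ux; apply: (@continuous_comp _ _ _ f (fun t : R => t `^ p)).
    exact: Cn_cont Hf _ _.
  apply/differentiable_continuous/derivable1_diffP.
  by have [] := is_derive1_powR p (fpos x Ux).
- move=> x Ux; apply: (@continuous_comp _ _ _ f (fun t : R => t `^ p)).
    exact: Cn_cont Hf _ _.
  apply/differentiable_continuous/derivable1_diffP.
  by have [] := is_derive1_powR p (fpos x Ux).
split=> [i x Ux|i].
  by have [] := is_derive_powR p (fpos x Ux) (Cn_derivable i Hf Ux).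
apply: (@eq_open_Cn _ _
  (fun z => p * f z `^ (p - 1) * partial i f z)) => //.
  move=> x /[1!inE] Ux; apply/esym/partialE.
  exact: is_derive_powR (fpos x Ux) (Cn_derivable i Hf Ux).
apply: Cn_mul => //; last exact: Cn_partial.
apply: Cn_mul => //; first exact: Cn_const.
by apply: IH; exact: CnW.
Qed.

Lemma Cn_inv k U f : open U -> (forall x, U x -> f x != 0) ->
  Cn k U f -> Cn k U (fun z => (f z)^-1).
Proof.
move=> oU fn0; elim: k => [|k IH] Hf; split=> //.
- by move=> x Ux; apply: continuousV; [exact: fn0|exact: Cn_cont Hf _ _].
- by move=> x Ux; apply: continuousV; [exact: fn0|exact: Cn_cont Hf _ _].
split=> [i x Ux|i].
  by have [] := is_derive_inv (fn0 x Ux) (Cn_derivable i Hf Ux).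
apply: (@eq_open_Cn _ _
  (fun z => -1 * ((f z)^-1 * (f z)^-1) * partial i f z)) => //.
  move=> x /[1!inE] Ux; apply/esym/partialE.
  have := is_derive_inv (fn0 x Ux) (Cn_derivable i Hf Ux).
  by rewrite -exprVn expr2 mulN1r.
apply: Cn_mul => //; last exact: Cn_partial.
apply: Cn_mul => //; first exact: Cn_const.
by apply: Cn_mul => //; apply: IH; exact: CnW.
Qed.

Lemma Cn_sum k U (I : Type) (s : seq I) (P : pred I) (h : I -> E -> R) :
  open U -> (forall i, P i -> Cn k U (h i)) ->
  Cn k U (fun z => \sum_(i <- s | P i) h i z).
Proof.
move=> oU H; elim: s => [|i s IH].
  under eq_fun do rewrite big_nil.
  exact: Cn_const.
under eq_fun do rewrite big_cons.
by case Pi: (P i) => //; apply: Cn_add => //; exact: H.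
Qed.

Lemma Cn_prod k U (I : Type) (s : seq I) (P : pred I) (h : I -> E -> R) :
  open U -> (forall i, P i -> Cn k U (h i)) ->
  Cn k U (fun z => \prod_(i <- s | P i) h i z).
Proof.
move=> oU H; elim: s => [|i s IH].
  under eq_fun do rewrite big_nil.
  exact: Cn_const.
under eq_fun do rewrite big_cons.
by case Pi: (P i) => //; apply: Cn_mul => //; exact: H.
Qed.

Lemma Cn_coord k U (j : 'I_n) : Cn k U (fun z => z 0 j).
Proof.
have cont x : {for x, continuous (fun z : E => z 0 j)} by exact: coord_continuous.
case: k => [|k]; split=> //; split=> [i x _|i].
  by have [] := is_derive_coord x (delta_mx 0 i) j.
have -> : partial i (fun z : E => z 0 j) = fun=> (delta_mx 0 i : E) 0 j.
  by apply/funext => x; apply: partialE; exact: is_derive_coord.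
exact: Cn_const.
Qed.

Lemma Cn_det k U d (A : E -> 'M[R]_d) : open U ->
  (forall i j, Cn k U (fun z => A z i j)) -> Cn k U (fun z => \det (A z)).
Proof.
move=> oU HA; apply: Cn_sum => // s _; apply: Cn_mul => //; first exact: Cn_const.
by apply: Cn_prod => // i _; exact: HA.
Qed.

(** Cramer's rule. *)
Lemma Cn_invmx k U d (A : E -> 'M[R]_d) : open U ->
  (forall x, U x -> A x \in unitmx) ->
  (forall i j, Cn k U (fun z => A z i j)) ->
  forall i j, Cn k U (fun z => invmx (A z) i j).
Proof.
move=> oU uA HA i j.
apply: (@eq_open_Cn _ _ (fun z => (\det (A z))^-1 * cofactor (A z) j i)) => //.
  by move=> x /[1!inE] Ux; rewrite /invmx uA // !mxE.
apply: Cn_mul => //.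
  apply: Cn_inv => //; last exact: Cn_det.
  by move=> x /uA; rewrite unitmxE unitfE.
rewrite /cofactor; apply: Cn_mul => //; first exact: Cn_const.
apply: Cn_det => // i' j'.
by under eq_fun do rewrite !mxE; exact: HA.
Qed.

Lemma Cn_mulmx k U d1 d2 d3 (A : E -> 'M[R]_(d1, d2)) (B : E -> 'M[R]_(d2, d3)) :
  open U -> (forall i j, Cn k U (fun z => A z i j)) ->
  (forall i j, Cn k U (fun z => B z i j)) ->
  forall i j, Cn k U (fun z => (A z *m B z) i j).
Proof.
move=> oU HA HB i j; under eq_fun do rewrite mxE.
by apply: Cn_sum => // l _; apply: Cn_mul.
Qed.

(** * Strict directional derivatives *)

(** The difference quotients converge uniformly with respect to the base point.
    This makes derivatives additive in the direction, which fails for plain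
    directional derivatives; it leads from continuous partial derivatives to
    derivatives in all directions, and to the symmetry of second derivatives. *)
Definition strict_derive f x v (d : R) : Prop :=
  forall e : R, 0 < e -> exists2 r : R, 0 < r &
    forall z (t : R), `|z - x| < r -> `|t| < r ->
      `|f (t *: v + z) - f z - t * d| <= e * `|t|.

Lemma strict_deriveD f x v w (d d' : R) :
  strict_derive f x v d -> strict_derive f x w d' ->
  strict_derive f x (v + w) (d + d').
Proof.
move=> Hv Hw e e0; have e20 : 0 < e / 2 by rewrite divr_gt0.
have [r1 r10 H1] := Hv _ e20; have [r2 r20 H2] := Hw _ e20.
pose K := 1 + `|w|.
have K0 : 0 < K by rewrite /K ltr_pwDl.
exists (Num.min (r1 / 2) (Num.min r2 (r1 / 2 / K))).
  by rewrite !lt_min r20 !divr_gt0.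
move=> z t; rewrite !lt_min => /and3P[zr1 zr2 zr3] /and3P[tr1 tr2 tr3].
have := H2 z t zr2 tr2; have := H1 (t *: w + z) t.
have -> : t *: (v + w) + z = t *: v + (t *: w + z) by rewrite scalerDr addrA.
have -> : `|t *: w + z - x| < r1.
  rewrite -addrA (le_lt_trans (ler_normD _ _))// (splitr r1) ltrD//.
  rewrite normrZ; move: tr3; rewrite ltr_pdivlMr//; apply: le_lt_trans.
  by rewrite ler_wpM2l// /K lerDr.
have -> : `|t| < r1 by apply: lt_trans tr1 _; rewrite ltr_pdivrMr// ltr_pMr// ltr1n.
move=> /(_ isT isT) h1 h2.
have -> : f (t *: v + (t *: w + z)) - f z - t * (d + d') =
  (f (t *: v + (t *: w + z)) - f (t *: w + z) - t * d) +
  (f (t *: w + z) - f z - t * d') by ring.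
rewrite (le_trans (ler_normD _ _))// (splitr e) mulrDl.
exact: lerD.
Qed.

Lemma strict_deriveZ f x v (d c : R) :
  strict_derive f x v d -> strict_derive f x (c *: v) (c * d).
Proof.
move=> Hv e e0; pose K := 1 + `|c|.
have K0 : 0 < K by rewrite /K ltr_pwDl.
have [r r0 H] := Hv (e / K) (divr_gt0 e0 K0).
exists (Num.min r (r / K)); first by rewrite lt_min r0 divr_gt0.
move=> z t; rewrite !lt_min => /andP[zr _] /andP[_ tr].
have := H z (t * c) zr.
have -> : `|t * c| < r.
  rewrite normrM; move: tr; rewrite ltr_pdivlMr//; apply: le_lt_trans.
  by rewrite ler_wpM2l// /K lerDr.
move=> /(_ isT); rewrite scalerA mulrA => h; apply: le_trans h _.
rewrite normrM.
have -> : e / K * (`|t| * `|c|) = e * `|t| * (`|c| / K) by ring.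
rewrite ler_piMr ?mulr_ge0 ?(ltW e0)//.
by rewrite ler_pdivrMr// mul1r /K lerDr.
Qed.

Lemma strict_derive0 f x : strict_derive f x 0 0.
Proof.
move=> e e0; exists 1 => // z t _ _.
by rewrite scaler0 add0r subrr mulr0 subr0 normr0 mulr_ge0 // ltW.
Qed.

Lemma mean_value_line f (z v : E) (t : R) :
  (forall s : R, `|s| <= `|t| -> derivable f (s *: v + z) v) ->
  exists2 s : R, `|s| <= `|t| &
    f (t *: v + z) - f z = t * 'D_v f (s *: v + z).
Proof.
move=> df.
pose g (s : R) : R := f (s *: v + z).
pose dg (s : R) : R := 'D_v f (s *: v + z).
have Hg (s : R) : `|s| <= `|t| -> is_derive s 1 g (dg s).
  move=> st; apply: (is_derive_line f z v s (dg s)).1.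
  by split=> //; exact: df.
have cont (A : set R) : (forall s, A s -> `|s| <= `|t|) ->
    {within A, continuous g}.
  move=> HA; apply: continuous_in_subspaceT => s /[1!inE] /HA st.
  by apply/differentiable_continuous/derivable1_diffP; have [] := Hg s st.
have [t0|t0] := leP 0 t.
- have bd (s : R) : 0 <= s <= t -> `|s| <= `|t|.
    by move=> /andP[s0 st]; rewrite !ger0_norm.
  have [s||s sin sE] := @MVT_segment R g dg 0 t t0.
  + by rewrite in_itv/= => /andP[s0 st]; apply: Hg; rewrite bd// !ltW.
  + by apply: cont => s; rewrite /= in_itv/=; exact: bd.
  + exists s; first by apply: bd; move: sin; rewrite in_itv.
    by move: sE; rewrite /g /dg scale0r add0r subr0 [RHS]mulrC.
- have bd (s : R) : t <= s <= 0 -> `|s| <= `|t|.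
    by move=> /andP[s0 st]; rewrite !ler0_norm// ?lerN2// ltW.
  have [s||s sin sE] := @MVT_segment R g dg t 0 (ltW t0).
  + by rewrite in_itv/= => /andP[s0 st]; apply: Hg; rewrite bd// !ltW.
  + by apply: cont => s; rewrite /= in_itv/=; exact: bd.
  + exists s; first by apply: bd; move: sin; rewrite in_itv.
    move: sE; rewrite /g /dg scale0r add0r sub0r => sE.
    by rewrite -opprB sE mulrN opprK mulrC.
Qed.

Lemma strict_derive_partial U f x i : open U -> U x -> Cn 1 U f ->
  strict_derive f x (delta_mx 0 i) (partial i f x).
Proof.
move=> oU Ux Hf e e0.
have cp := Cn_cont (Cn_partial i Hf) Ux.
have /nbhs_ballP[r1 /= r10 H1] : nbhs x U by apply: open_nbhs_nbhs; split.
have /cvgrPdist_le/(_ e e0)/nbhs_ballP[r2 /= r20 H2] := cp.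
pose ei : E := delta_mx 0 i; pose K := 1 + `|ei|.
have K0 : 0 < K by rewrite /K ltr_pwDl.
pose r := Num.min r1 r2; have r0 : 0 < r by rewrite lt_min r10.
exists (Num.min (r / 2) (r / 2 / K)); first by rewrite lt_min !divr_gt0.
move=> z t; rewrite !lt_min => /andP[zr _] /andP[_ tr].
have near (s : R) : `|s| <= `|t| -> ball x r (s *: ei + z).
  move=> st; rewrite -ball_normE /= distrC -addrA.
  rewrite (le_lt_trans (ler_normD _ _))// (splitr r) ltrD// normrZ.
  move: tr; rewrite ltr_pdivlMr//; apply: le_lt_trans.
  by rewrite ler_pM// /K lerDr.
have [s st ->] : exists2 s : R, `|s| <= `|t| &
    f (t *: ei + z) - f z = t * 'D_ei f (s *: ei + z).
  apply: mean_value_line => s st; have [_ [df _]] := Hf; apply: df.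
  by apply: H1; apply: le_ball (near s st); rewrite ge_min lexx.
rewrite -mulrBr normrM mulrC ler_wpM2r// distrC; apply: H2.
by apply: le_ball (near s st); rewrite ge_min lexx orbT.
Qed.

Lemma C1_strict_derive U f x v : open U -> U x -> Cn 1 U f ->
  strict_derive f x v (\sum_i v 0 i * partial i f x).
Proof.
move=> oU Ux Hf; rewrite {1}[v]row_sum_delta.
elim/big_ind2: _ => [||i _]; first exact: strict_derive0.
  by move=> *; exact: strict_deriveD.
by apply: strict_deriveZ; exact: strict_derive_partial Hf.
Qed.

Lemma strict_derive_is_derive f x v (d : R) :
  strict_derive f x v d -> is_derive x v f d.
Proof.
move=> H.
have L : (fun h : R => h^-1 *: ((f \o shift x) (h *: v) - f x)) @ 0^' --> d.
  apply/cvgrPdist_le => e e0; have [r r0 Hr] := H e e0.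
  near=> h.
  have h0 : h != 0 by near: h; exact: nbhs_dnbhs_neq.
  rewrite /= -[d](mulKf h0) -[_ *: _]/(_ * _) -mulrBr normrM normfV.
  rewrite mulrC ler_pdivrMr ?normr_gt0// distrC.
  apply: Hr; first by rewrite subrr normr0.
  by near: h; apply: dnbhs0_lt.
by split; [apply/cvg_ex; exists d|exact/cvg_lim].
Unshelve. all: by end_near. Qed.

Lemma C1_is_derive U f x v : open U -> U x -> Cn 1 U f ->
  is_derive x v f (\sum_i v 0 i * partial i f x).
Proof.
by move=> oU Ux Hf; apply: strict_derive_is_derive; exact: C1_strict_derive Hf.
Qed.

(** By the mean value theorem in direction i, the second difference is t times an
    increment of the i-th partial derivative in direction j, which the strict
    derivative of that partial derivative controls. *)
Lemma second_difference U f x i j : open U -> U x -> Cn 2 U f ->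
  forall e : R, 0 < e -> exists2 d : R, 0 < d & forall t : R, `|t| < d ->
  `|f (t *: delta_mx 0 i + (t *: delta_mx 0 j + x)) - f (t *: delta_mx 0 j + x)
    - f (t *: delta_mx 0 i + x) + f x - t * (t * partial j (partial i f) x)|
  <= e * `|t| * `|t|.
Proof.
move=> oU Ux Hf e e0.
have [r r0 Hr] := strict_derive_partial j oU Ux (Cn_partial i Hf) e0.
have /nbhs_ballP[r1 /= r10 H1] : nbhs x U by apply: open_nbhs_nbhs; split.
pose ei : E := delta_mx 0 i; pose ej : E := delta_mx 0 j.
pose K := 1 + `|ei| + `|ej|.
have K0 : 0 < K by rewrite /K -addrA ltr_pwDl// addr_ge0.
pose r2 := Num.min r r1; have r20 : 0 < r2 by rewrite lt_min r0.
exists (Num.min r (r2 / K)); first by rewrite lt_min r0 divr_gt0.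
move=> t; rewrite lt_min => /andP[tr trK].
have near1 (s s' : R) : `|s| <= `|t| -> `|s'| <= `|t| ->
    `|s *: ei + (s' *: ej + x) - x| < r2.
  move=> st st'; rewrite addrA addrK.
  rewrite (le_lt_trans (ler_normD _ _))// !normrZ.
  move: trK; rewrite ltr_pdivlMr//; apply: le_lt_trans.
  rewrite /K !mulrDr mulr1 lerD// ?ler_wpM2r//.
  by rewrite -[X in X <= _]add0r lerD// ler_wpM2r.
have inU (s s' : R) : `|s| <= `|t| -> `|s'| <= `|t| ->
    U (s *: ei + (s' *: ej + x)).
  move=> st st'; apply: H1; rewrite -ball_normE /= distrC.
  by apply: lt_le_trans (near1 s s' st st') _; rewrite ge_min lexx orbT.
pose g (z : E) := f (t *: ej + z) - f z.
have Hpf (z : E) : U z -> is_derive z ei f (partial i f z).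
  by move=> Uz; exact: Cn_derivable Hf Uz.
have dg (s : R) : `|s| <= `|t| -> is_derive (s *: ei + x) ei g
    (partial i f (t *: ej + (s *: ei + x)) - partial i f (s *: ei + x)).
  move=> st; apply: (@is_deriveB _ _ _ (fun z => f (t *: ej + z)) f).
    by apply: is_derive_translate; apply: Hpf; rewrite addrCA; exact: inU.
  apply: Hpf; have := inU s 0 st; rewrite scale0r add0r normr0; exact.
have [s st sE] : exists2 s : R, `|s| <= `|t| &
    g (t *: ei + x) - g x = t * 'D_ei g (s *: ei + x).
  by apply: mean_value_line => s /dg[].
have -> : f (t *: delta_mx 0 i + (t *: delta_mx 0 j + x)) -
   f (t *: delta_mx 0 j + x) - f (t *: delta_mx 0 i + x) + f x =
   t * 'D_ei g (s *: ei + x).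
  by rewrite -sE /g /ei /ej [t *: delta_mx 0 j + (_ + _)]addrCA; ring.
have [_ ->] := dg s st.
rewrite -mulrBr normrM -mulrA mulrCA ler_wpM2l// .
apply: Hr => //.
have := near1 s 0 st; rewrite scale0r add0r normr0 => /(_ (normr_ge0 _)) h.
by apply: lt_le_trans h _; rewrite ge_min lexx.
Qed.

(** The second difference is symmetric in the two directions. *)
Lemma partialC U f x i j : open U -> U x -> Cn 2 U f ->
  partial i (partial j f) x = partial j (partial i f) x.
Proof.
move=> oU Ux Hf; apply/eqP; rewrite -subr_eq0 -normr_le0.
apply/ler_addgt0Pl => e e0; rewrite addr0.
have e20 : 0 < e / 2 by rewrite divr_gt0.
have [r1 r10 H1] := second_difference i j oU Ux Hf e20.
have [r2 r20 H2] := second_difference j i oU Ux Hf e20.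
pose r := Num.min r1 r2; have r0 : 0 < r by rewrite lt_min r10.
pose t := r / 2; have t0 : 0 < t by rewrite divr_gt0.
have tr : `|t| < r by rewrite gtr0_norm// ltr_pdivrMr// ltr_pMr// ltr1n.
have := H1 t; have := H2 t.
rewrite !(lt_le_trans tr) ?ge_min ?lexx ?orbT// => /(_ isT) h2 /(_ isT) h1.
rewrite -(ler_pM2r t0) -(ler_pM2r t0) -{1 2}(gtr0_norm t0) -!normrM.
rewrite -{3 4}(gtr0_norm t0).
have -> : e * `|t| * `|t| = e / 2 * `|t| * `|t| + e / 2 * `|t| * `|t| by field.
apply: le_trans (lerD h1 h2).
apply: le_trans (ler_normB _ _).
rewrite [t *: 'e_j + (t *: 'e_i + x)]addrCA le_eqVlt; apply/orP; left.
apply/eqP; congr (`|_|).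
have alg (a b c d p q s : R) : (p - q) * s * s =
    a - b - c + d - s * (s * q) - (a - c - b + d - s * (s * p)) by ring.
exact: alg.
Qed.

End Calculus.

(** * Bilinear forms *)

Lemma addmx_entry (R : nmodType) m n (A B : 'M[R]_(m, n)) i j :
  (A + B) i j = A i j + B i j.
Proof. by rewrite mxE. Qed.

Lemma oppmx_entry (R : zmodType) m n (A : 'M[R]_(m, n)) i j : (- A) i j = - A i j.
Proof. by rewrite mxE. Qed.

Lemma scalemx_entry (R : pzRingType) m n (c : R) (A : 'M[R]_(m, n)) i j :
  (c *: A) i j = c * A i j.
Proof. by rewrite mxE. Qed.

(** Reading off entries without expanding the matrix products, which [ring]
    then treats as atoms. *)
Definition entryE := (addmx_entry, oppmx_entry, scalemx_entry).

Section Forms.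
Context {R : realType} {n : nat}.
Local Notation E := 'rV[R]_n.
Implicit Types (a : 'M[R]_n) (b x y z v w : E) (c : R).

Definition quad a y z : R := \sum_k \sum_l a k l * y 0 k * z 0 l.
Definition pair b y : R := \sum_k b 0 k * y 0 k.

Lemma quadE a y z : quad a y z = (y *m a *m z^T) 0 0.
Proof.
rewrite /quad mxE exchange_big /=; apply: eq_bigr => l _; rewrite !mxE mulr_suml.
by apply: eq_bigr => k _; rewrite [a k l * _]mulrC.
Qed.

Lemma pairE b y : pair b y = (b *m y^T) 0 0.
Proof. by rewrite mxE; apply: eq_bigr => k _; rewrite mxE. Qed.

Lemma quadDl a y1 y2 z : quad a (y1 + y2) z = quad a y1 z + quad a y2 z.
Proof. by rewrite !quadE !mulmxDl mxE. Qed.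

Lemma quadDr a y z1 z2 : quad a y (z1 + z2) = quad a y z1 + quad a y z2.
Proof. by rewrite !quadE linearD mulmxDr mxE. Qed.

Lemma quadZl a c y z : quad a (c *: y) z = c * quad a y z.
Proof. by rewrite !quadE -!scalemxAl mxE. Qed.

Lemma quadZr a c y z : quad a y (c *: z) = c * quad a y z.
Proof. by rewrite !quadE linearZ -scalemxAr mxE. Qed.

Lemma quadC a y z : a^T = a -> quad a y z = quad a z y.
Proof.
move=> sa; rewrite !quadE -[in RHS]sa -{2}[z]trmxK -!trmx_mul mulmxA.
by rewrite [RHS]mxE.
Qed.

Lemma quad_delta a k l : quad a (delta_mx 0 k) (delta_mx 0 l) = a k l.
Proof. by rewrite quadE -rowE trmx_delta -colE !mxE. Qed.

Lemma pairDr b y z : pair b (y + z) = pair b y + pair b z.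
Proof. by rewrite !pairE linearD mulmxDr mxE. Qed.

Lemma pairZr b c y : pair b (c *: y) = c * pair b y.
Proof. by rewrite !pairE linearZ -scalemxAr mxE. Qed.

Lemma pair_mulmx w a y : pair (w *m a) y = quad a w y.
Proof. by rewrite pairE quadE. Qed.

Lemma quad_scale a c y z : quad (c *: a) y z = c * quad a y z.
Proof. by rewrite !quadE -scalemxAr -scalemxAl mxE. Qed.

Lemma quad_add (a a' : 'M[R]_n) y z : quad (a + a') y z = quad a y z + quad a' y z.
Proof. by rewrite !quadE mulmxDr mulmxDl mxE. Qed.

Lemma pair_scale b c y : pair (c *: b) y = c * pair b y.
Proof. by rewrite !pairE -scalemxAl mxE. Qed.

Lemma pair_add b b' y : pair (b + b') y = pair b y + pair b' y.
Proof. by rewrite !pairE mulmxDl mxE. Qed.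

(** By polarisation. *)
Lemma quad_eq0 a : a^T = a -> (forall y, quad a y y = 0) -> a = 0.
Proof.
move=> sa H; apply/matrixP => k l; rewrite mxE -quad_delta.
have := H (delta_mx 0 k + delta_mx 0 l).
rewrite quadDl !quadDr !H (quadC _ (delta_mx 0 l) sa) add0r addr0 => h.
by lra.
Qed.

Lemma is_derive_quadl a y v z : is_derive y v (fun y => quad a y z) (quad a v z).
Proof.
apply: is_derive_bigsum => k _; apply: is_derive_bigsum => l _.
have := is_derive_mul (is_derive_mul (is_derive_const (a k l) y v)
  (is_derive_coord y v k)) (is_derive_const (z 0 l) y v).
by move=> H; apply: is_derive_eq H _; rewrite mul0r add0r mulr0 addr0.
Qed.

Lemma is_derive_quad a y v : a^T = a ->
  is_derive y v (fun y => quad a y y) (2 * quad a y v).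
Proof.
move=> sa.
have -> : 2 * quad a y v = \sum_k \sum_l (a k l * v 0 k * y 0 l + a k l * y 0 k * v 0 l).
  under eq_bigr do rewrite big_split /=.
  by rewrite big_split /= -/(quad a v y) -/(quad a y v) (quadC _ _ sa); ring.
apply: is_derive_bigsum => k _; apply: is_derive_bigsum => l _.
have := is_derive_mul (is_derive_mul (is_derive_const (a k l) y v)
  (is_derive_coord y v k)) (is_derive_coord y v l).
by move=> H; apply: is_derive_eq H _; rewrite mul0r add0r.
Qed.

Lemma is_derive_pair b y v : is_derive y v (fun y => pair b y) (pair b v).
Proof.
apply: is_derive_bigsum => k _.
have := is_derive_mul (is_derive_const (b 0 k) y v) (is_derive_coord y v k).
by move=> H; apply: is_derive_eq H _; rewrite mul0r add0r.
Qed.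

Lemma Cn_quad k (U : set E) a : open U -> Cn k U (fun y => quad a y y).
Proof.
move=> oU; apply: Cn_sum => // i _; apply: Cn_sum => // j _.
apply: Cn_mul => //; last exact: Cn_coord.
by apply: Cn_mul => //; [exact: Cn_const|exact: Cn_coord].
Qed.

Lemma Cn_pair k (U : set E) b : open U -> Cn k U (fun y => pair b y).
Proof.
move=> oU; apply: Cn_sum => // i _.
by apply: Cn_mul => //; [exact: Cn_const|exact: Cn_coord].
Qed.

Lemma open_pair_gt0 b : open [set y | 0 < pair b y].
Proof.
have cp : continuous (pair b).
  by move=> y; have [H _] := Cn_pair 0 b (@openT E); exact: H.
have -> : [set y | 0 < pair b y] = pair b @^-1` [set t | 0 < t] by [].
by apply: open_comp => [y _|]; [exact: cp|exact: open_gt].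
Qed.

Lemma posdef_unitmx a : (forall y, y != 0 -> 0 < quad a y y) -> a \in unitmx.
Proof.
move=> pa; rewrite unitmxE unitfE; apply/negP => /det0P[v v0 va].
by have := pa v v0; rewrite quadE va mul0mx mxE ltxx.
Qed.

End Forms.

(** * The energy of an m-Kropina metric and its derivatives *)

Section Energy.
Context {R : realType} {n : nat}.
Local Notation E := 'rV[R]_n.
Implicit Types (a : 'M[R]_n) (b x y z v w : E).

(** With p = 1 - m and q = 2 m this is the square of an m-Kropina metric, and with
    p = (1 - m) / 2 and q = m the metric itself. *)
Definition energy (p q : R) a b y : R := quad a y y `^ p * pair b y `^ q.

(** The derivative of log [energy] at [y] in the direction [z]. *)
Definition dlog_energy (p q : R) a b y z : R :=
  2 * p * quad a y z / quad a y y + q * pair b z / pair b y.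

(** The second derivative of [energy] at [y] in the directions [z] and [w], divided
    by [energy]. *)
Definition hess_energy (p q : R) a b y z w : R :=
  dlog_energy p q a b y z * dlog_energy p q a b y w
  + 2 * p * quad a z w / quad a y y
  - 4 * p * quad a y z * quad a y w / quad a y y ^+ 2
  - q * pair b z * pair b w / pair b y ^+ 2.

Lemma powR_subr1 (t p : R) : 0 < t -> t `^ (p - 1) = t `^ p / t.
Proof.
by move=> t0; rewrite powRB ?powRr1 ?(ltW t0)// (gt_eqF t0) implybT.
Qed.

Lemma is_derive_powRM (f g : E -> R) x v (p q df dg : R) :
  0 < f x -> 0 < g x -> is_derive x v f df -> is_derive x v g dg ->
  is_derive x v (fun z => f z `^ p * g z `^ q)
    (f x `^ p * g x `^ q * (p * df / f x + q * dg / g x)).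
Proof.
move=> f0 g0 Hf Hg.
have := is_derive_mul (is_derive_powR p f0 Hf) (is_derive_powR q g0 Hg).
by move=> H; apply: is_derive_eq H _; rewrite !powR_subr1//; ring.
Qed.

Lemma is_derive_energy p q a b y v : a^T = a -> 0 < quad a y y -> 0 < pair b y ->
  is_derive y v (energy p q a b) (energy p q a b y * dlog_energy p q a b y v).
Proof.
move=> sa A0 B0.
have := @is_derive_powRM (fun y => quad a y y) (pair b) y v p q _ _ A0 B0
  (is_derive_quad y v sa) (is_derive_pair b y v).
by move=> H; apply: is_derive_eq H _; rewrite /dlog_energy mulrA [p * 2]mulrC.
Qed.

Lemma is_derive_denergy p q a b y z v : a^T = a -> 0 < quad a y y -> 0 < pair b y ->
  is_derive y v (fun y => energy p q a b y * dlog_energy p q a b y z)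
    (energy p q a b y * hess_energy p q a b y z v).
Proof.
move=> sa A0 B0.
have H1 := @is_derive_div _ _ _ (fun y => quad a y y) _ _ _ _ (lt0r_neq0 A0)
  (is_derive_scale (2 * p) (is_derive_quadl a y v z)) (is_derive_quad y v sa).
have H2 := @is_derive_div _ _ _ (pair b) _ _ _ _ (lt0r_neq0 B0)
  (is_derive_const (q * pair b z) y v) (is_derive_pair b y v).
have := is_derive_mul (is_derive_energy p q v sa A0 B0) (is_derive_add H1 H2).
move=> H; apply: is_derive_eq H _.
rewrite /hess_energy /dlog_energy (quadC v z sa); ring.
Qed.

Lemma Cn_energy k (U : set E) p q a b : open U ->
  (forall y, U y -> 0 < quad a y y /\ 0 < pair b y) -> Cn k U (energy p q a b).
Proof.
move=> oU H; apply: Cn_mul => //; apply: Cn_powR => //.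
- by move=> y /H[].
- exact: Cn_quad.
- by move=> y /H[].
- exact: Cn_pair.
Qed.

End Energy.

(** * The spray along lines parallel to the axis *)

Section LineAlgebra.
Context {R : realType}.
Implicit Types (m u k g h : R).

(** The form [hess_energy] at the direction y = u W + w, with W of unit length, dual
    to the form and orthogonal to w, and k = |w|^2. The second argument of the form
    is a vector S with components g = b(S) and h = a(w, S), and its first argument is
    W here and w in [hess_transversal]. The factors 1 and 0 are b(W) and b(w). *)
Definition hess_axis m u k g h : R :=
  let A := u ^+ 2 + k in let p := 1 - m in let q := 2 * m in
  (2 * p * u / A + q * 1 / u) * (2 * p * (u * g + h) / A + q * g / u)
  + 2 * p * g / A - 4 * p * u * (u * g + h) / A ^+ 2 - q * 1 * g / u ^+ 2.

Definition hess_transversal m u k g h : R :=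
  let A := u ^+ 2 + k in let p := 1 - m in let q := 2 * m in
  (2 * p * k / A + q * 0 / u) * (2 * p * (u * g + h) / A + q * g / u)
  + 2 * p * h / A - 4 * p * k * (u * g + h) / A ^+ 2 - q * 0 * g / u ^+ 2.

Lemma restricted_hess_inj m u k g h :
  u != 0 -> u ^+ 2 + k != 0 -> m != 1 -> m * k - u ^+ 2 != 0 ->
  hess_axis m u k g h = 0 -> hess_transversal m u k g h = 0 -> g = 0 /\ h = 0.
Proof.
move=> u0 A0 m1 D0 e1 e2; have p0 : 1 - m != 0 by rewrite subr_eq0 eq_sym.
(* The determinant of the system. *)
have det0 : - 4 * (1 - m) * (m * k - u ^+ 2) / (u ^+ 2 * (u ^+ 2 + k) ^+ 2) != 0.
  rewrite mulf_neq0 ?invr_neq0 ?mulf_neq0 ?expf_neq0 ?oppr_eq0 ?pnatr_eq0//.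
split; apply: (mulfI det0); rewrite mulr0.
  transitivity (hess_axis m u k g h * hess_transversal m u k 0 1 - hess_transversal m u k g h * hess_axis m u k 0 1).
    by rewrite /hess_axis /hess_transversal; field; rewrite u0 A0.
  by rewrite e1 e2 !mul0r subrr.
transitivity (hess_transversal m u k g h * hess_axis m u k 1 0 - hess_axis m u k g h * hess_transversal m u k 1 0).
  by rewrite /hess_axis /hess_transversal; field; rewrite u0 A0.
by rewrite e1 e2 !mul0r subrr.
Qed.

(** The components b(H) and a(w, H) of the difference H between the spray of the
    m-Kropina metric and the spray of the Riemannian metric. *)
Definition axis_coef m u k (rho sigma : R) : R :=
  (m / 2 * rho * (k - u ^+ 2) - 2 * m * sigma * k * u) / (m * k - u ^+ 2).

Definition transversal_coef m u k (rho sigma : R) : R :=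
  - (m * rho * u * k) / (m * k - u ^+ 2)
  + m / (1 - m) * sigma
    * (4 * m * k ^+ 2 / (m * k - u ^+ 2) - (u ^+ 2 + 3 * k)).

(** The right-hand sides are those of the spray equation contracted with W and w;
    the solution is checked, and it is unique by [restricted_hess_inj]. [X1 / 4] and
    [X2 / 4] are the components of the Riemannian spray. *)
Lemma restricted_spray m u k rho sigma X1 X2 g h :
  u != 0 -> u ^+ 2 + k != 0 -> m != 1 -> m * k - u ^+ 2 != 0 ->
  let A := u ^+ 2 + k in let p := 1 - m in let q := 2 * m in
  let A0 := u * X1 + X2 in let B0 := rho - 2 * u * sigma + X1 / 2 in
  2 * hess_axis m u k g h =
    (2 * p * u / A + q * 1 / u) * (p * A0 / A + q * B0 / u) + p * X1 / A
    - 2 * p * A0 * u / A ^+ 2 + q * (2 * sigma) / u - q * B0 * 1 / u ^+ 2 ->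
  2 * hess_transversal m u k g h =
    (2 * p * k / A + q * 0 / u) * (p * A0 / A + q * B0 / u) + p * X2 / A
    - 2 * p * A0 * k / A ^+ 2 + q * (- 2 * u * sigma) / u - q * B0 * 0 / u ^+ 2 ->
  g = X1 / 4 + axis_coef m u k rho sigma /\
  h = X2 / 4 + transversal_coef m u k rho sigma.
Proof.
move=> u0 A0 m1 D0 /= e1 e2; have p0 : 1 - m != 0 by rewrite subr_eq0 eq_sym.
have [||] := @restricted_hess_inj m u k (g - (X1 / 4 + axis_coef m u k rho sigma))
  (h - (X2 / 4 + transversal_coef m u k rho sigma)) u0 A0 m1 D0; last first.
- by move=> /subr0_eq -> /subr0_eq ->.
- transitivity (2^-1 * (2 * hess_transversal m u k g h) -
    hess_transversal m u k (X1 / 4 + axis_coef m u k rho sigma)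
      (X2 / 4 + transversal_coef m u k rho sigma)).
    by rewrite /hess_transversal; field; rewrite u0 A0.
  rewrite e2 /hess_transversal /axis_coef /transversal_coef; field.
  by rewrite u0 A0 p0 D0.
- transitivity (2^-1 * (2 * hess_axis m u k g h) -
    hess_axis m u k (X1 / 4 + axis_coef m u k rho sigma)
      (X2 / 4 + transversal_coef m u k rho sigma)).
    by rewrite /hess_axis; field; rewrite u0 A0.
  rewrite e1 /hess_axis /axis_coef /transversal_coef; field.
  by rewrite u0 A0 p0 D0.
Qed.

End LineAlgebra.

(** * Rational functions of one variable *)

Section OneVariable.
Context {R : realType}.
Implicit Types (m u k s t : R).

Lemma eq_is_derive_unique (I : set R) (f g df dg : R -> R) :
  open I -> (forall t, I t -> f t = g t) ->
  (forall t, I t -> is_derive t 1 f (df t)) ->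
  (forall t, I t -> is_derive t 1 g (dg t)) ->
  forall t, I t -> df t = dg t.
Proof.
move=> oI fg Hf Hg t It; have [_ <-] := Hf t It; have [_ <-] := Hg t It.
apply: near_eq_derive.
have : nbhs t I by apply: open_nbhs_nbhs; split.
by apply: filterS => s; exact: fg.
Qed.

(** The parameters of the directions, on a line parallel to the axis, where the
    m-Kropina metric is defined and its fundamental tensor is regular. *)
Definition regular_axis (K : R) : set R := [set t | 0 < t /\ K - t ^+ 2 != 0].

Lemma open_regular_axis K : open (regular_axis K).
Proof.
have -> : regular_axis K = [set t | 0 < t] `&` (fun t => K - t ^+ 2) @^-1` [set t | t != 0].
  by [].
apply: openI; first exact: open_gt.
apply: open_comp => [t _|]; last exact: open_neq.
apply: (@continuousB _ _ _ (fun=> K) (fun t => t ^+ 2)); first exact: cst_continuous.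
exact: exprn_continuous.
Qed.

Lemma is_derive_idR t : is_derive t (1 : R) (fun t => t) (1 : R).
Proof. exact: is_derive_id. Qed.

Lemma is_derive_pow_inv K (i : nat) t : K - t ^+ 2 != 0 ->
  is_derive t (1 : R) (fun t => (K - t ^+ 2)^-1 ^+ i)
    (i%:R * 2 * t * (K - t ^+ 2)^-1 ^+ i.+1).
Proof.
move=> D0.
have HD : is_derive t (1 : R) (fun t => K - t ^+ 2) (- 2 * t).
  have := is_derive_add (is_derive_const K t (1 : R))
    (is_derive_scale (-1) (is_derive_mul (is_derive_idR t) (is_derive_idR t))).
  under eq_fun do rewrite -expr2 mulN1r.
  by move=> H; apply: is_derive_eq H _; ring.
have Hinv := @is_derive_inv _ _ (fun t => K - t ^+ 2) t 1 _ D0 HD.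
elim: i => [|i IH].
  under eq_fun do rewrite expr0.
  by rewrite !mul0r; exact: is_derive_const.
have := is_derive_mul Hinv IH.
under eq_fun do rewrite -exprS.
move=> H; apply: is_derive_eq H _.
by rewrite -natr1 !exprS; field.
Qed.

Lemma is_derive_cubic (a b c d t : R) :
  is_derive t (1 : R) (fun t => a + b * t + c * t ^+ 2 + d * t ^+ 3)
    (b + 2 * c * t + 3 * d * t ^+ 2).
Proof.
have H1 := is_derive_idR t; have H2 := is_derive_mul H1 H1.
have H3 := is_derive_mul H2 H1.
have := is_derive_add (is_derive_add (is_derive_add (is_derive_const a t 1)
  (is_derive_scale b H1)) (is_derive_scale c H2)) (is_derive_scale d H3).
have -> : (fun x : R => a + b * x + c * (x * x) + d * (x * x * x)) =
    (fun t : R => a + b * t + c * t ^+ 2 + d * t ^+ 3).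
  by apply/funext => x; ring.
by move=> H; apply: is_derive_eq H _; ring.
Qed.

(** Differentiating is done on the functions X^i, with X = 1 / (K - t^2), since
    (X^i)' = 2 i t X^(i+1). The quadratic part disappears. *)
Lemma third_derivative_fraction K (f0 f1 f2 f3 : R -> R) c0 c1 c2 d0 d1 :
  (forall t, regular_axis K t -> is_derive t 1 f0 (f1 t)) ->
  (forall t, regular_axis K t -> is_derive t 1 f1 (f2 t)) ->
  (forall t, regular_axis K t -> is_derive t 1 f2 (f3 t)) ->
  (forall t, regular_axis K t ->
    f0 t = c0 + c1 * t + c2 * t ^+ 2 + (d0 + d1 * t) / (K - t ^+ 2)) ->
  forall t, regular_axis K t ->
    f3 t * (K - t ^+ 2) ^+ 4 =
    6 * d1 * (K - t ^+ 2) ^+ 2 + (24 * d0 * t + 48 * d1 * t ^+ 2) * (K - t ^+ 2)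
    + 48 * t ^+ 3 * (d0 + d1 * t).
Proof.
move=> H1 H2 H3 H0.
pose X t := (K - t ^+ 2)^-1.
pose cub (a b c d t : R) := a + b * t + c * t ^+ 2 + d * t ^+ 3.
have oI := @open_regular_axis K.
have dcub a b c d i t : regular_axis K t ->
    is_derive t (1 : R) (fun t => cub a b c d t * X t ^+ i)
      ((b + 2 * c * t + 3 * d * t ^+ 2) * X t ^+ i
       + cub a b c d t * (i%:R * 2 * t * X t ^+ i.+1)).
  by move=> [_ D0]; apply: is_derive_mul (is_derive_cubic a b c d t) (is_derive_pow_inv i D0).
pose h0 t := cub c0 c1 c2 0 t * X t ^+ 0 + cub d0 d1 0 0 t * X t ^+ 1.
pose h1 t := cub c1 (2 * c2) 0 0 t * X t ^+ 0 + cub d1 0 0 0 t * X t ^+ 1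
  + cub 0 (2 * d0) (2 * d1) 0 t * X t ^+ 2.
pose h2 t := cub (2 * c2) 0 0 0 t * X t ^+ 0 + cub (2 * d0) (6 * d1) 0 0 t * X t ^+ 2
  + cub 0 0 (8 * d0) (8 * d1) t * X t ^+ 3.
pose h3 t := 6 * d1 * X t ^+ 2 + (24 * d0 * t + 48 * d1 * t ^+ 2) * X t ^+ 3
  + 48 * t ^+ 3 * (d0 + d1 * t) * X t ^+ 4.
have D0 t : regular_axis K t -> is_derive t 1 h0 (h1 t).
  move=> It; have := is_derive_add (dcub c0 c1 c2 0 0%N t It) (dcub d0 d1 0 0 1%N t It).
  by move=> H; apply: is_derive_eq H _; rewrite /h1 /cub; ring.
have D1 t : regular_axis K t -> is_derive t 1 h1 (h2 t).
  move=> It; have := is_derive_add (is_derive_add (dcub c1 (2 * c2) 0 0 0%N t It)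
    (dcub d1 0 0 0 1%N t It)) (dcub 0 (2 * d0) (2 * d1) 0 2%N t It).
  by move=> H; apply: is_derive_eq H _; rewrite /h2 /cub; ring.
have D2 t : regular_axis K t -> is_derive t 1 h2 (h3 t).
  move=> It; have := is_derive_add (is_derive_add (dcub (2 * c2) 0 0 0 0%N t It)
    (dcub (2 * d0) (6 * d1) 0 0 2%N t It)) (dcub 0 0 (8 * d0) (8 * d1) 3%N t It).
  by move=> H; apply: is_derive_eq H _; rewrite /h3 /cub; ring.
have E0 t : regular_axis K t -> f0 t = h0 t.
  by move=> /H0 ->; rewrite /h0 /cub /X; ring.
have E1 := eq_is_derive_unique oI E0 H1 D0.
have E2 := eq_is_derive_unique oI E1 H2 D1.
have E3 := eq_is_derive_unique oI E2 H3 D2.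
move=> t /[dup] It [_ K0]; rewrite E3// /h3 /X; field.
by rewrite K0.
Qed.

Lemma large_axis (m k : R) : 0 < k ->
  exists s : R, 0 < s /\ forall t, s <= t -> `|m| * k < t ^+ 2.
Proof.
move=> k0; pose s := `|m| * k + 1.
have s1 : 1 <= s by rewrite /s lerDr mulr_ge0 // ltW.
have s0 : 0 < s by apply: lt_le_trans s1.
exists s; split=> // t st; have t0 := lt_le_trans s0 st.
have : `|m| * k < t by apply: lt_le_trans st; rewrite /s ltrDl.
move=> /lt_le_trans; apply; rewrite expr2 ler_peMr ?(ltW t0)//.
exact: le_trans st.
Qed.

Lemma regular_axis_large (m k s t : R) : 0 < k -> 0 < s ->
  (forall t, s <= t -> `|m| * k < t ^+ 2) -> s <= t -> regular_axis (m * k) t.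
Proof.
move=> k0 s0 H st; split; first exact: lt_le_trans st.
rewrite subr_eq0 lt_eqF//; apply: le_lt_trans (H t st).
by rewrite ler_wpM2r ?(ltW k0)// ler_norm.
Qed.

(** The hypothesis is the vanishing of the third derivative of
    [third_derivative_fraction] for the coefficients that come from
    [axis_coef] and [transversal_coef]. It factors as 6 m k (m k - t^2)^2 times a
    quadratic polynomial in t, whose coefficients involve rho and sigma. *)
Lemma landsberg_axis m k rho sigma : m != 0 -> m != 1 -> 0 < k ->
  (forall t, regular_axis (m * k) t ->
    let d0 := (t ^+ 2 + m * k) * (m / 2 * rho * (1 - m) * k)
              + (1 - m) * t * (m / (1 - m) * sigma * (4 * m * k ^+ 2)) in
    let d1 := - (t ^+ 2 + m * k) * (2 * m * k * sigma)
              - (1 - m) * t * (m * rho * k) in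
    let D := m * k - t ^+ 2 in
    6 * d1 * D ^+ 2 + (24 * d0 * t + 48 * d1 * t ^+ 2) * D
    + 48 * t ^+ 3 * (d0 + d1 * t) = 0) ->
  rho = 0 /\ sigma = 0.
Proof.
move=> m0 m1 k0 H; have p0 : 1 - m != 0 by rewrite subr_eq0 eq_sym.
have H' t : regular_axis (m * k) t ->
    (1 - m) * rho * t - 2 * sigma * (t ^+ 2 + m * k) = 0.
  move=> /[dup] It [t0 D0]; have /= e := H t It.
  have c0 : 6 * m * k * (m * k - t ^+ 2) ^+ 2 != 0.
    by rewrite !mulf_neq0 ?expf_neq0 ?pnatr_eq0 ?(gt_eqF k0).
  apply: (mulfI c0); rewrite mulr0 -[RHS]e; field.
  by rewrite p0.
(* Two large values of t separate rho from sigma. *)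
have [s [s0 Hs]] := large_axis m k0.
have mk t : s <= t -> - (t ^+ 2) < m * k /\ m * k < t ^+ 2.
  move=> /Hs h; have := ler_norm m; have := ler_norm (- m); rewrite normrN.
  move=> h1 h2; have := ler_wpM2r (ltW k0) h1; have := ler_wpM2r (ltW k0) h2; lra.
have s2 : s <= 2 * s by lra.
have e1 := H' _ (regular_axis_large k0 s0 Hs (lexx s)).
have e2 := H' _ (regular_axis_large k0 s0 Hs s2).
have [mk1 mk2] := mk s (lexx s).
have : sigma * (m * k - 2 * s ^+ 2) = 0.
  have -> : sigma * (m * k - 2 * s ^+ 2) =
    (((1 - m) * rho * (2 * s) - 2 * sigma * ((2 * s) ^+ 2 + m * k))
    - 2 * ((1 - m) * rho * s - 2 * sigma * (s ^+ 2 + m * k))) / 2 by field.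
  by rewrite e1 e2; ring.
move=> /eqP; rewrite mulf_eq0 => /orP[/eqP sg0|/eqP h]; last by lra.
split=> //; move: e1; rewrite sg0 mulr0 mul0r subr0 => /eqP.
by rewrite !mulf_eq0 (negbTE p0) (gt_eqF s0) orbF /= => /eqP.
Qed.

Lemma horner_eq0_large (p : {poly R}) (s : R) :
  (forall t, s <= t -> p.[t] = 0) -> p = 0.
Proof.
move=> H; apply/eqP/negPn/negP => p0.
pose rs := [seq s + i%:R | i <- iota 0 (size p)].
have : (size rs < size p)%N.
  apply: max_poly_roots => //.
    apply/allP => t /mapP[i _ ->]; apply/eqP/H.
    by rewrite lerDl ler0n.
  rewrite map_inj_uniq ?iota_uniq// => i j /addrI /eqP.
  by rewrite eqr_nat => /eqP.
by rewrite size_map size_iota ltnn.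
Qed.

(** The degree of (K - X^2) p is at least 2 unless p = 0. *)
Lemma fraction_not_poly (K s n0 n1 : R) (p : {poly R}) :
  (forall t, s <= t -> n0 + n1 * t = (K - t ^+ 2) * p.[t]) -> n0 = 0 /\ n1 = 0.
Proof.
move=> H.
have E : n0%:P + n1 *: 'X = (K%:P - 'X^2) * p.
  apply/eqP; rewrite -subr_eq0; apply/eqP/(@horner_eq0_large _ s) => t st.
  by rewrite !hornerE H// subrr.
have p0 : p = 0.
  apply/eqP/negPn/negP => p0.
  have : (size ((K%:P - 'X^2) * p)%R <= 2)%N.
    rewrite -E (leq_trans (size_polyD _ _))// geq_max.
    rewrite (leq_trans (size_polyC_leq1 _))//= (leq_trans (size_scale_leq _ _))//.
    by rewrite size_polyX.
  have sK : size (K%:P - 'X^2) = 3%N.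
    rewrite addrC size_polyDl size_polyN ?size_polyXn//.
    by rewrite (leq_ltn_trans (size_polyC_leq1 _)).
  have : (0 < size p)%N by rewrite size_poly_gt0.
  by rewrite size_mul -?size_poly_eq0 ?sK ?size_poly_eq0//; case: (size p).
move: E; rewrite p0 mulr0 => E; split.
  have := congr1 (fun r : {poly R} => r`_0) E.
  by rewrite /= coefD coefZ coefC coefX coef0 mulr0 addr0.
have := congr1 (fun r : {poly R} => r`_1) E.
by rewrite /= coefD coefZ coefC coefX coef0 mulr1 add0r.
Qed.

(** Up to a polynomial, the combination is a fraction whose numerator has the
    coefficients m (1 + m) k^2 rho / 2 and - 2 m (1 + m) k^2 sigma / (1 - m). *)
Lemma douglas_axis m k rho sigma (p : {poly R}) :
  m != 0 -> m != 1 -> m != -1 -> 0 < k ->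
  (forall t, regular_axis (m * k) t ->
    k * axis_coef m t k rho sigma - t * transversal_coef m t k rho sigma = p.[t]) ->
  rho = 0 /\ sigma = 0.
Proof.
move=> m0 m1 mN1 k0 H; have p0 : 1 - m != 0 by rewrite subr_eq0 eq_sym.
have k0' : k != 0 by rewrite gt_eqF.
have mp : 1 + m != 0 by rewrite addrC addr_eq0.
have [s [s0 Hs]] := large_axis m k0.
pose q : {poly R} := p + (m / 2 * rho * k)%:P
  - (m / (1 - m) * sigma) *: ('X^3 + (3 * k) *: 'X).
have [|e0 e1] := @fraction_not_poly (m * k) s (m / 2 * rho * k ^+ 2 * (1 + m))
  (- (2 * m * k ^+ 2 * sigma * (1 + m) / (1 - m))) q.
  move=> t /(regular_axis_large k0 s0 Hs) /[dup] It [t0 D0].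
  have -> : q.[t] = p.[t] + m / 2 * rho * k
      - m / (1 - m) * sigma * (t ^+ 3 + 3 * k * t) by rewrite /q !hornerE.
  rewrite -H// /axis_coef /transversal_coef; field.
  by rewrite p0 D0.
move: e0 e1 => /eqP e0 /eqP e1; split; apply/eqP.
  move: e0; rewrite !mulf_eq0 invr_eq0 (negbTE m0) (negbTE k0') (negbTE mp).
  by rewrite pnatr_eq0 /= !orbF.
move: e1; rewrite oppr_eq0 !mulf_eq0 invr_eq0 (negbTE m0) (negbTE k0').
by rewrite (negbTE mp) (negbTE p0) pnatr_eq0 /= !orbF.
Qed.

End OneVariable.

(** * Lie derivatives in coordinates *)

Section LieDerivative.
Context {R : realType} {n : nat}.
Local Notation E := 'rV[R]_n.
Implicit Types (f g : E -> R) (U : set E) (x : E) (V W : E -> E).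

Definition vderive V f x : R := \sum_k V x 0 k * partial k f x.

Definition mderive m1 m2 V (A : E -> 'M[R]_(m1, m2)) x : 'M[R]_(m1, m2) :=
  \matrix_(i, j) vderive V (fun z => A z i j) x.

Definition jac V x : 'M[R]_n := \matrix_(i, j) partial i (fun z => V z 0 j) x.

(** The Lie derivative of a covariant two-tensor. *)
Definition lie V (A : E -> 'M[R]_n) x : 'M[R]_n :=
  mderive V A x + jac V x *m A x + A x *m (jac V x)^T.

Definition bracket V W x : E := V x *m jac W x - W x *m jac V x.

Definition mCn k U m1 m2 (A : E -> 'M[R]_(m1, m2)) := forall i j, Cn k U (fun z => A z i j).

Lemma mCnW k U m1 m2 (A : E -> 'M[R]_(m1, m2)) : mCn k.+1 U A -> mCn k U A.
Proof. by move=> H i j; exact: CnW. Qed.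

Lemma eq_open_vderive U V f g x : open U -> U x -> {in U, f =1 g} ->
  vderive V f x = vderive V g x.
Proof.
move=> oU Ux fg; apply: eq_bigr => k _.
by rewrite (eq_open_partial oU fg) ?inE.
Qed.

Lemma eq_open_mderive m1 m2 U V (A B : E -> 'M[R]_(m1, m2)) x : open U -> U x ->
  {in U, A =1 B} -> mderive V A x = mderive V B x.
Proof.
move=> oU Ux AB; apply/matrixP => i j; rewrite !mxE.
by apply: eq_open_vderive oU Ux _ => z /AB ->.
Qed.

Lemma eq_open_jac U V W x : open U -> U x -> {in U, V =1 W} -> jac V x = jac W x.
Proof.
move=> oU Ux VW; apply/matrixP => i j; rewrite !mxE.
by apply: (eq_open_partial oU) => [z /VW -> //|]; rewrite inE.
Qed.

Lemma partialD U f g i x : U x -> Cn 1 U f -> Cn 1 U g ->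
  partial i (fun z => f z + g z) x = partial i f x + partial i g x.
Proof.
move=> Ux Hf Hg; apply: partialE.
exact: is_derive_add (Cn_derivable i Hf Ux) (Cn_derivable i Hg Ux).
Qed.

Lemma partialM U f g i x : U x -> Cn 1 U f -> Cn 1 U g ->
  partial i (fun z => f z * g z) x = partial i f x * g x + f x * partial i g x.
Proof.
move=> Ux Hf Hg; apply: partialE.
exact: is_derive_mul (Cn_derivable i Hf Ux) (Cn_derivable i Hg Ux).
Qed.

Lemma partial_sum U (I : Type) (s : seq I) (P : pred I) (h : I -> E -> R) i x :
  U x -> (forall j, P j -> Cn 1 U (h j)) ->
  partial i (fun z => \sum_(j <- s | P j) h j z) x =
  \sum_(j <- s | P j) partial i (h j) x.
Proof.
move=> Ux H; apply: partialE; apply: is_derive_bigsum => j Pj.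
exact: Cn_derivable (H j Pj) Ux.
Qed.

Lemma vderiveD U V f g x : U x -> Cn 1 U f -> Cn 1 U g ->
  vderive V (fun z => f z + g z) x = vderive V f x + vderive V g x.
Proof.
move=> Ux Hf Hg; rewrite -big_split; apply: eq_bigr => k _ /=.
by rewrite (partialD _ Ux Hf Hg) mulrDr.
Qed.

Lemma vderiveM U V f g x : U x -> Cn 1 U f -> Cn 1 U g ->
  vderive V (fun z => f z * g z) x = vderive V f x * g x + f x * vderive V g x.
Proof.
move=> Ux Hf Hg; rewrite mulr_suml mulr_sumr -big_split; apply: eq_bigr => k _ /=.
by rewrite (partialM _ Ux Hf Hg); ring.
Qed.

Lemma vderive_sum U V (I : Type) (s : seq I) (P : pred I) (h : I -> E -> R) x :
  U x -> (forall j, P j -> Cn 1 U (h j)) ->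
  vderive V (fun z => \sum_(j <- s | P j) h j z) x =
  \sum_(j <- s | P j) vderive V (h j) x.
Proof.
move=> Ux H; rewrite /vderive exchange_big; apply: eq_bigr => k _ /=.
by rewrite (partial_sum _ _ Ux H) mulr_sumr.
Qed.

Lemma mderiveD m1 m2 U V (A B : E -> 'M[R]_(m1, m2)) x : U x ->
  mCn 1 U A -> mCn 1 U B ->
  mderive V (fun z => A z + B z) x = mderive V A x + mderive V B x.
Proof.
move=> Ux HA HB; apply/matrixP => i j; rewrite !mxE.
under [X in vderive _ X]eq_fun do rewrite mxE.
exact: (vderiveD V Ux (HA i j) (HB i j)).
Qed.

Lemma mderiveM m1 m2 m3 U V (A : E -> 'M[R]_(m1, m2)) (B : E -> 'M[R]_(m2, m3)) x :
  open U -> U x -> mCn 1 U A -> mCn 1 U B ->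
  mderive V (fun z => A z *m B z) x = mderive V A x *m B x + A x *m mderive V B x.
Proof.
move=> oU Ux HA HB; apply/matrixP => i j; rewrite !mxE.
under [X in vderive _ X]eq_fun do rewrite mxE.
rewrite (vderive_sum _ _ Ux); last by move=> l _; exact: Cn_mul.
rewrite -big_split; apply: eq_bigr => l _ /=.
by rewrite (vderiveM _ Ux)// !mxE.
Qed.

Lemma mderive_tr m1 m2 V (A : E -> 'M[R]_(m1, m2)) x :
  mderive V (fun z => (A z)^T) x = (mderive V A x)^T.
Proof.
apply/matrixP => i j; rewrite !mxE.
by under [X in vderive _ X]eq_fun do rewrite mxE.
Qed.

Lemma mderive_scale m1 m2 U V f (A : E -> 'M[R]_(m1, m2)) x :
  U x -> Cn 1 U f -> mCn 1 U A ->
  mderive V (fun z => f z *: A z) x = vderive V f x *: A x + f x *: mderive V A x.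
Proof.
move=> Ux Hf HA; apply/matrixP => i j; rewrite !mxE.
under [X in vderive _ X]eq_fun do rewrite mxE.
exact: (vderiveM V Ux Hf (HA i j)).
Qed.

Lemma Cn_jac k U V : mCn k.+1 U V -> mCn k U (jac V).
Proof.
by move=> HV i j; under eq_fun do rewrite mxE; exact: Cn_partial.
Qed.

Lemma Cn_vderive k U V f : open U -> mCn k U V -> Cn k.+1 U f ->
  Cn k U (vderive V f).
Proof.
by move=> oU HV Hf; apply: Cn_sum => // i _; apply: Cn_mul => //; exact: Cn_partial.
Qed.

Lemma mCn_mul k U m1 m2 m3 (A : E -> 'M[R]_(m1, m2)) (B : E -> 'M[R]_(m2, m3)) :
  open U -> mCn k U A -> mCn k U B -> mCn k U (fun z => A z *m B z).
Proof. exact: Cn_mulmx. Qed.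

Lemma mCn_add k U m1 m2 (A B : E -> 'M[R]_(m1, m2)) :
  open U -> mCn k U A -> mCn k U B -> mCn k U (fun z => A z + B z).
Proof. by move=> oU HA HB i j; under eq_fun do rewrite mxE; exact: Cn_add. Qed.

Lemma mCn_tr k U m1 m2 (A : E -> 'M[R]_(m1, m2)) :
  mCn k U A -> mCn k U (fun z => (A z)^T).
Proof. by move=> HA i j; under eq_fun do rewrite mxE; exact: HA. Qed.

Lemma mCn_derive k U m1 m2 V (A : E -> 'M[R]_(m1, m2)) : open U -> mCn k U V ->
  mCn k.+1 U A -> mCn k U (mderive V A).
Proof.
by move=> oU HV HA i j; under eq_fun do rewrite mxE; exact: Cn_vderive.
Qed.

(** Second partial derivatives commute, so that only the derivatives of the
    components of the two fields survive. *)
Lemma vderive_commutator U V W f x : open U -> U x ->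
  mCn 1 U V -> mCn 1 U W -> Cn 2 U f ->
  vderive V (vderive W f) x - vderive W (vderive V f) x =
  vderive (bracket V W) f x.
Proof.
have half A B : open U -> U x -> mCn 1 U A -> mCn 1 U B -> Cn 2 U f ->
    vderive A (vderive B f) x = \sum_i (A x *m jac B x) 0 i * partial i f x
     + \sum_k \sum_i A x 0 k * B x 0 i * partial k (partial i f) x.
  move=> oU Ux HA HB Hf; rewrite (vderive_sum _ _ Ux); last first.
    by move=> i _; apply: Cn_mul => //; exact: Cn_partial.
  rewrite [X in _ = _ + X]exchange_big -big_split; apply: eq_bigr => i _ /=.
  rewrite (vderiveM _ Ux (HB 0 i) (Cn_partial i Hf)).
  rewrite mxE; congr (_ * _ + _).
    by apply: eq_bigr => k _; rewrite mxE.
  by rewrite mulr_sumr; apply: eq_bigr => k _; ring.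
move=> oU Ux HV HW Hf; rewrite !half//.
have -> : \sum_k \sum_i W x 0 k * V x 0 i * partial k (partial i f) x =
    \sum_k \sum_i V x 0 k * W x 0 i * partial k (partial i f) x.
  rewrite exchange_big; apply: eq_bigr => k _; apply: eq_bigr => i _ /=.
  by rewrite (partialC i k oU Ux Hf) [W x _ _ * _]mulrC.
rewrite opprD addrACA subrr addr0 -sumrB; apply: eq_bigr => i _.
by rewrite [in RHS]mxE [in X in _ = (_ + X) * _]mxE mulrDl mulNr.
Qed.

(** The term with second derivatives of W is a derivative of [jac W] along [V] because
    these derivatives are symmetric. *)
Lemma jac_mul U V W x : open U -> U x -> mCn 1 U V -> mCn 2 U W ->
  jac (fun z => V z *m jac W z) x = jac V x *m jac W x + mderive V (jac W) x.
Proof.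
move=> oU Ux HV HW; apply/matrixP => i l; rewrite !mxE.
under [X in partial _ X]eq_fun do rewrite mxE.
rewrite (partial_sum _ _ Ux); last first.
  by move=> k _; apply: Cn_mul => //; exact: Cn_jac.
rewrite -big_split; apply: eq_bigr => k _ /=.
rewrite (partialM _ Ux)//; last exact: Cn_jac.
rewrite !mxE; congr (_ + _ * _).
under [in LHS]eq_fun do rewrite mxE.
under [in RHS]eq_fun do rewrite mxE.
exact: partialC oU Ux (HW 0 l).
Qed.

Lemma jac_bracket U V W x : open U -> U x -> mCn 2 U V -> mCn 2 U W ->
  jac (bracket V W) x = jac V x *m jac W x + mderive V (jac W) x
    - (jac W x *m jac V x + mderive W (jac V) x).
Proof.
move=> oU Ux HV HW.
rewrite -(jac_mul oU Ux (mCnW HV) HW) -(jac_mul oU Ux (mCnW HW) HV).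
apply/matrixP => i l; rewrite !mxE -[- partial _ _ _]mulN1r.
have C1 (A B : E -> E) : mCn 2 U A -> mCn 2 U B ->
    is_derive x (delta_mx 0 i) (fun z => (A z *m jac B z) 0 l)
      (partial i (fun z => (A z *m jac B z) 0 l) x).
  move=> HA HB; apply: (@Cn_derivable _ _ 0 U) => //.
  by apply: (@mCn_mul 1) => //; [exact: mCnW|exact: Cn_jac].
apply: partialE.
have -> : (fun z => bracket V W z 0 l) =
    (fun z => (V z *m jac W z) 0 l + -1 * (W z *m jac V z) 0 l).
  by apply/funext => z; rewrite /bracket mulN1r mxE [in X in _ + X = _]mxE.
by apply: is_derive_add; [exact: C1|apply: is_derive_scale; exact: C1].
Qed.

Lemma mderive_commutator U V W (A : E -> 'M[R]_n) x : open U -> U x ->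
  mCn 1 U V -> mCn 1 U W -> mCn 2 U A ->
  mderive V (mderive W A) x - mderive W (mderive V A) x =
  mderive (bracket V W) A x.
Proof.
move=> oU Ux HV HW HA; apply/matrixP => i j; rewrite !mxE.
under [X in vderive _ X x - _]eq_fun do rewrite mxE.
under [X in _ - vderive _ X x]eq_fun do rewrite mxE.
exact: (vderive_commutator oU Ux HV HW (HA i j)).
Qed.

(** The expansion of a double Lie derivative, antisymmetrised: [VWA] stands for the
    derivative along V of the derivative of A along W, [JV] for the jacobian of V,
    [VJW] for the derivative along V of the jacobian of W, and so on. *)
Lemma lie_commutator_algebra (A VA WA VWA WVA JV JW VJW WJV : 'M[R]_n) :
  (VWA + (VJW *m A + JW *m VA) + (VA *m JW^T + A *m VJW^T)
   + JV *m (WA + JW *m A + A *m JW^T) + (WA + JW *m A + A *m JW^T) *m JV^T) -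
  (WVA + (WJV *m A + JV *m WA) + (WA *m JV^T + A *m WJV^T)
   + JW *m (VA + JV *m A + A *m JV^T) + (VA + JV *m A + A *m JV^T) *m JW^T) =
  VWA - WVA + (JV *m JW + VJW - (JW *m JV + WJV)) *m A
   + A *m (JV *m JW + VJW - (JW *m JV + WJV))^T.
Proof.
have trD (P Q : 'M[R]_n) : (P + Q)^T = P^T + Q^T by rewrite linearD.
have trN (P : 'M[R]_n) : (- P)^T = - P^T by rewrite linearN.
rewrite !(trD, trN, trmx_mul).
rewrite !mulmxDl !mulmxDr !mulNmx !mulmxN !mulmxDl !mulmxDr !mulmxA.
by apply/matrixP => i j; rewrite !entryE; ring.
Qed.

Lemma mderive_lie U V W (A : E -> 'M[R]_n) x : open U -> U x ->
  mCn 1 U V -> mCn 2 U W -> mCn 2 U A ->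
  mderive V (lie W A) x = mderive V (mderive W A) x
    + (mderive V (jac W) x *m A x + jac W x *m mderive V A x)
    + (mderive V A x *m (jac W x)^T + A x *m (mderive V (jac W) x)^T).
Proof.
move=> oU Ux HV HW HA; have H1 := mCnW HA; have HJ := Cn_jac HW.
have HJt := mCn_tr HJ; have HD := mCn_derive oU (mCnW HW) HA.
have HP := mCn_mul oU HJ H1; have HQ := mCn_mul oU H1 HJt.
have HS := mCn_add oU HD HP.
have -> := mderiveD V Ux HS HQ; have -> := mderiveD V Ux HD HP.
have -> := mderiveM V oU Ux HJ H1; have -> := mderiveM V oU Ux H1 HJt.
by rewrite mderive_tr.
Qed.

Lemma lie_commutator U V W (A : E -> 'M[R]_n) x : open U -> U x ->
  mCn 2 U V -> mCn 2 U W -> mCn 2 U A ->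
  lie V (lie W A) x - lie W (lie V A) x = lie (bracket V W) A x.
Proof.
move=> oU Ux HV HW HA; rewrite {1}/lie (mderive_lie oU Ux (mCnW HV) HW HA).
rewrite [X in _ - X]/lie (mderive_lie oU Ux (mCnW HW) HV HA).
rewrite [RHS]/lie -(mderive_commutator oU Ux (mCnW HV) (mCnW HW) HA).
rewrite (jac_bracket oU Ux HV HW) /lie.
exact: lie_commutator_algebra.
Qed.

End LieDerivative.

(** * Unit one-forms and their dual fields *)

Section UnitForm.
Context {R : realType} {n : nat}.
Local Notation E := 'rV[R]_n.
Implicit Types (U : set E) (x y z v w : E) (V W b : E -> E) (a : E -> 'M[R]_n).

(** The data of a normalised m-Kropina metric in one chart; three derivatives leave
    room for differentiating Lie derivatives. *)
Record unit_dual U a b W : Prop := UnitDual {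
  ud_open : open U ;
  ud_metric : mCn 3 U a ;
  ud_form : mCn 3 U b ;
  ud_field : mCn 3 U W ;
  ud_sym : forall x, U x -> (a x)^T = a x ;
  ud_pos : forall x, U x -> forall y, y != 0 -> 0 < quad (a x) y y ;
  ud_dual : forall x, U x -> W x *m a x = b x ;
  ud_unit : forall x, U x -> quad (a x) (W x) (W x) = 1
}.

Lemma pair_eq0 (b : E) : (forall y, pair b y = 0) -> b = 0.
Proof.
move=> H; apply/rowP => j; rewrite mxE -[RHS](H (delta_mx 0 j)).
by rewrite pairE trmx_delta -colE mxE.
Qed.

Lemma exists_transversal (b : E) : (2 <= n)%N -> exists2 w : E, w != 0 & pair b w = 0.
Proof.
case: n b => [|[|n']] // b _.
have pd j c : pair b (c *: delta_mx 0 j) = c * b 0 j.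
  by rewrite pairZr pairE trmx_delta -colE mxE.
have [b00|b00] := eqVneq (b 0 0) 0.
  exists (1 *: delta_mx 0 0); last by rewrite pd b00 mulr0.
  apply/eqP => /rowP/(_ 0); rewrite !mxE eqxx mulr1 => /eqP.
  by rewrite oner_eq0.
exists (b 0 1 *: delta_mx 0 0 + (- b 0 0) *: delta_mx 0 1); last first.
  by rewrite pairDr !pd; ring.
apply/eqP => /rowP/(_ 1); rewrite !mxE eqxx /= mulr0 add0r mulr1 => /eqP.
by rewrite oppr_eq0 (negbTE b00).
Qed.

Section Dual.
Context {U : set E} {a : E -> 'M[R]_n} {b W : E -> E}.
Hypothesis H : unit_dual U a b W.

Lemma quad_dual x y : U x -> quad (a x) (W x) y = pair (b x) y.
Proof. by move=> Ux; rewrite -(ud_dual H Ux) pair_mulmx. Qed.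

Lemma pair_dual x : U x -> pair (b x) (W x) = 1.
Proof. by move=> Ux; rewrite -quad_dual// (ud_unit H Ux). Qed.

Lemma transversal_decomposition x y : U x -> exists u w,
  y = u *: W x + w /\ pair (b x) w = 0.
Proof.
move=> Ux; exists (pair (b x) y), (y - pair (b x) y *: W x).
split; first by rewrite addrC subrK.
by rewrite pairDr -scaleN1r pairZr pairZr pair_dual//; ring.
Qed.

Lemma symmetric_mderive x V : U x -> (mderive V a x)^T = mderive V a x.
Proof.
move=> Ux; rewrite -mderive_tr; apply: eq_open_mderive (ud_open H) Ux _ => z.
by rewrite inE => /(ud_sym H).
Qed.

Lemma mderive_dual x V y : U x ->
  pair (mderive V b x) y = quad (a x) (mderive V W x) y + quad (mderive V a x) (W x) y.
Proof.
move=> Ux.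
have -> : mderive V b x = mderive V (fun z => W z *m a z) x.
  apply: eq_open_mderive (ud_open H) Ux _ => z.
  by rewrite inE => /(ud_dual H).
rewrite (mderiveM V (ud_open H) Ux) ?pair_add ?pair_mulmx//.
  by do 2! apply: mCnW; exact: (ud_field H).
by do 2! apply: mCnW; exact: (ud_metric H).
Qed.

(** Differentiating [b(W) = a(W, W) = 1]. *)
Lemma mderive_unit x V : U x ->
  2 * pair (mderive V b x) (W x) = quad (mderive V a x) (W x) (W x).
Proof.
move=> Ux.
have C1b : mCn 1 U b by do 2! apply: mCnW; exact: (ud_form H).
have C1W : mCn 1 U W by do 2! apply: mCnW; exact: (ud_field H).
have e0 : mderive V (fun z => b z *m (W z)^T) x = 0.
  have -> : mderive V (fun z => b z *m (W z)^T) x = mderive V (fun=> 1%:M : 'M[R]_1) x.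
    apply: eq_open_mderive (ud_open H) Ux _ => z /[1!inE] Uz.
    apply/matrixP => i j; rewrite !ord1 -pairE pair_dual// !mxE eqxx.
    by [].
  apply/matrixP => i j; rewrite !mxE; apply: big1 => k _.
  rewrite (_ : partial _ _ _ = 0) ?mulr0//.
  by apply: partialE; exact: is_derive_const.
have := mderiveM V (ud_open H) Ux C1b (mCn_tr C1W).
rewrite e0 mderive_tr => /matrixP/(_ 0 0); rewrite mxE [in RHS]mxE -!pairE.
rewrite -(quad_dual _ Ux) (quadC _ _ (ud_sym H Ux)).
by have := mderive_dual V (W x) Ux; lra.
Qed.

(** A field whose Lie derivatives rescale the metric and its unit form is
    homothetic as soon as the dual field is Killing: L_[V,W] = L_V L_W - L_W L_V
    makes (W c) a proportional to the symmetrised product of dc and b, and the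
    quadratic form of that product vanishes on the vectors orthogonal to W. *)
Lemma conformal_factor_gradient V (c : E -> R) x i : (2 <= n)%N -> U x ->
  mCn 2 U V -> Cn 1 U c ->
  (forall z, U z -> lie W a z = 0) ->
  (forall z, U z -> lie V a z = (4 * c z) *: a z) ->
  (forall z, U z -> bracket V W z = (-2 * c z) *: W z) ->
  partial i c x = 0.
Proof.
move=> n2 Ux HV Hc LW LV BVW; have oU := ud_open H.
have C2W : mCn 2 U W by apply: mCnW; exact: (ud_field H).
have C2a : mCn 2 U a by apply: mCnW; exact: (ud_metric H).
have C1a := mCnW C2a; have C1W := mCnW C2W.
have lieE (A B : E -> 'M[R]_n) Z : {in U, A =1 B} -> lie Z A x = lie Z B x.
  by move=> AB; rewrite /lie (eq_open_mderive _ oU Ux AB) AB ?inE.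
pose g : E := \row_i partial i c x.
have vc Z : vderive Z c x = pair g (Z x).
  by apply: eq_bigr => k _; rewrite mxE mulrC.
have e1 : lie V (lie W a) x = 0.
  rewrite (lieE _ (fun=> 0)); last by move=> z /[1!inE] /LW.
  rewrite /lie mulmx0 mul0mx !addr0; apply/matrixP => k l; rewrite !mxE.
  apply: big1 => j _; rewrite (_ : partial _ _ _ = 0) ?mulr0//.
  by apply: partialE; under eq_fun do rewrite mxE; exact: is_derive_const.
have e2 : lie W (lie V a) x = (4 * pair g (W x)) *: a x.
  rewrite (lieE _ (fun z => (4 * c z) *: a z)); last by move=> z /[1!inE] /LV.
  have C4 : Cn 1 U (fun z => 4 * c z) := Cn_mul oU (Cn_const 1 U 4) Hc.
  have -> : lie W (fun z => (4 * c z) *: a z) x =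
      vderive W (fun z => 4 * c z) x *: a x + (4 * c x) *: lie W a x.
    rewrite /lie (mderive_scale W Ux C4 C1a) -scalemxAr -scalemxAl !scalerDr.
    by rewrite !addrA.
  rewrite LW// scaler0 addr0 (vderiveM W Ux (Cn_const 1 U 4) Hc) vc.
  rewrite (_ : vderive W (fun=> 4) x = 0) ?mul0r ?add0r//.
  apply: big1 => k _; rewrite (_ : partial _ _ _ = 0) ?mulr0//.
  by apply: partialE; exact: is_derive_const.
have e3 : lie (bracket V W) a x = -2 *: (g^T *m b x + (b x)^T *m g).
  have jB : jac (bracket V W) x = -2 *: (g^T *m W x + c x *: jac W x).
    rewrite (@eq_open_jac _ _ U _ (fun z => (-2 * c z) *: W z))//; last first.
      by move=> z /[1!inE] /BVW.
    apply/matrixP => k l; rewrite !mxE big_ord1 !mxE.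
    apply: partialE; under eq_fun do rewrite mxE -mulrA.
    apply: is_derive_scale.
    exact: is_derive_mul (Cn_derivable k Hc Ux) (Cn_derivable k (C1W 0 l) Ux).
  have mB : mderive (bracket V W) a x = (-2 * c x) *: mderive W a x.
    apply/matrixP => k l; rewrite !mxE /vderive BVW// mulr_sumr.
    by apply: eq_bigr => j _; rewrite mxE; ring.
  have -> : lie (bracket V W) a x = (-2 * c x) *: lie W a x
      - 2 *: (g^T *m b x + (b x)^T *m g).
    rewrite /lie jB mB -(ud_dual H Ux) trmx_mul (ud_sym H Ux).
    have trD (P Q : 'M[R]_n) : (P + Q)^T = P^T + Q^T by rewrite linearD.
    have trZ (k : R) (P : 'M[R]_n) : (k *: P)^T = k *: P^T by rewrite linearZ.
    rewrite !(trD, trZ) trmx_mul trmxK -!(scalemxAl, scalemxAr).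
    rewrite !(mulmxDl, mulmxDr) -!(scalemxAl, scalemxAr) !mulmxA.
    by apply/matrixP => k l; rewrite !entryE; ring.
  by rewrite LW// scaler0 add0r scaleNr.
have key Z : pair g Z * pair (b x) Z = pair g (W x) * quad (a x) Z Z.
  have := lie_commutator oU Ux HV C2W C2a; rewrite e1 e2 e3 sub0r => e.
  have := congr1 (fun M => quad M Z Z) e.
  have qgb (p q : E) : quad (p^T *m q) Z Z = pair p Z * pair q Z.
    rewrite quadE mulmxA -mulmxA mxE big_ord1 -pairE.
    by rewrite -pairE; congr (_ * _); apply: eq_bigr => k _; rewrite mulrC.
  by rewrite -scaleN1r !quad_scale quad_add !qgb; lra.
have [w w0 bw] := exists_transversal (b x) n2.
have gW : pair g (W x) = 0.
  have := key w; rewrite bw mulr0 => /esym/eqP; rewrite mulf_eq0.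
  by rewrite (gt_eqF (ud_pos H Ux w0)) orbF => /eqP.
have g0 : g = 0.
  apply: pair_eq0 => Z; have := key (Z + W x); have := key Z.
  by rewrite gW !mul0r !pairDr (pair_dual Ux) gW; nra.
by move: g0 => /rowP/(_ i); rewrite !mxE.
Qed.

(** Lie differentiation of b = a(W, -). *)
Lemma bracket_dual V (c : E -> R) x : U x -> mCn 2 U V ->
  lie V a x = (4 * c x) *: a x ->
  mderive V b x + b x *m (jac V x)^T = (2 * c x) *: b x ->
  bracket V W x = (-2 * c x) *: W x.
Proof.
move=> Ux HV LV Lb; have ua := posdef_unitmx (ud_pos H Ux).
apply: (can_inj (mulmxK ua)); rewrite -scalemxAl (ud_dual H Ux).
have C1a : mCn 1 U a by do 2! apply: mCnW; exact: (ud_metric H).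
have C1W : mCn 1 U W by do 2! apply: mCnW; exact: (ud_field H).
have bE : mderive V b x = mderive V W x *m a x + W x *m mderive V a x.
  rewrite -(mderiveM V (ud_open H) Ux C1W C1a).
  apply: eq_open_mderive (ud_open H) Ux _ => z.
  by rewrite inE => /(ud_dual H).
have VW : mderive V W x = V x *m jac W x.
  apply/rowP => j; rewrite !mxE; apply: eq_bigr => k _.
  by rewrite !mxE.
have e := congr1 (fun M => W x *m M) LV.
move: e Lb; rewrite /lie bE VW -(ud_dual H Ux) -scalemxAr (ud_dual H Ux).
rewrite /bracket mulmxBl !mulmxDr !mulmxA (ud_dual H Ux) => e1 e2.
apply/matrixP => i j; move: e1 e2 => /matrixP/(_ i j) e1 /matrixP/(_ i j).
by move: e1; rewrite !entryE; lra.
Qed.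

End Dual.
End UnitForm.

(** * First derivatives of the metric in position and direction *)

Section KropinaChart.
Context {R : realType} {n : nat}.
Local Notation E := 'rV[R]_n.
Implicit Types (x y z v w : E).

Lemma sum_delta_linear (f : E -> R) (Z : E) :
  (forall u v, f (u + v) = f u + f v) -> (forall c u, f (c *: u) = c * f u) ->
  \sum_l Z 0 l * f (delta_mx 0 l) = f Z.
Proof.
move=> fD fZ; rewrite {2}[Z]row_sum_delta (big_morph f fD (_ : f 0 = 0)).
  by apply: eq_bigr => l _; rewrite fZ.
by rewrite -(scale0r (0 : E)) fZ mul0r.
Qed.

Context {U : set E} {a : E -> 'M[R]_n} {b W : E -> E}.
Hypothesis H : unit_dual U a b W.
Variables (p q : R) (G : E -> E -> R).
Hypothesis GE : forall x y, U x -> 0 < pair (b x) y ->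
  G x y = energy p q (a x) (b x) y.

Definition xderive (v : E) m1 m2 (A : E -> 'M[R]_(m1, m2)) x := mderive (fun=> v) A x.

Lemma xderiveD u v m1 m2 (A : E -> 'M[R]_(m1, m2)) x :
  xderive (u + v) A x = xderive u A x + xderive v A x.
Proof.
apply/matrixP => i j; rewrite !mxE -big_split; apply: eq_bigr => k _ /=.
by rewrite mxE mulrDl.
Qed.

Lemma xderiveZ c v m1 m2 (A : E -> 'M[R]_(m1, m2)) x :
  xderive (c *: v) A x = c *: xderive v A x.
Proof.
apply/matrixP => i j; rewrite !mxE mulr_sumr; apply: eq_bigr => k _ /=.
by rewrite mxE mulrA.
Qed.

Lemma mderiveE (V : E -> E) m1 m2 (A : E -> 'M[R]_(m1, m2)) x :
  mderive V A x = xderive (V x) A x.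
Proof. by apply/matrixP => i j; rewrite !mxE. Qed.

Lemma Cn1_metric : mCn 1 U a.
Proof. by do 2! apply: mCnW; exact: (ud_metric H). Qed.

Lemma Cn1_form : mCn 1 U b.
Proof. by do 2! apply: mCnW; exact: (ud_form H). Qed.

Lemma is_derive_metric x v y y' : U x ->
  is_derive x v (fun z => quad (a z) y y') (quad (xderive v a x) y y').
Proof.
move=> Ux; apply: is_derive_bigsum => i _; apply: is_derive_bigsum => j _.
have := is_derive_mul (is_derive_mul (C1_is_derive v (ud_open H) Ux (Cn1_metric i j))
  (is_derive_const (y 0 i) x v)) (is_derive_const (y' 0 j) x v).
by move=> D; apply: is_derive_eq D _; rewrite !mulr0 !addr0 mxE.
Qed.

Lemma is_derive_form x v y : U x ->
  is_derive x v (fun z => pair (b z) y) (pair (xderive v b x) y).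
Proof.
move=> Ux; apply: is_derive_bigsum => i _.
have := is_derive_mul (C1_is_derive v (ud_open H) Ux (Cn1_form 0 i))
  (is_derive_const (y 0 i) x v).
by move=> D; apply: is_derive_eq D _; rewrite !mulr0 !addr0 mxE.
Qed.

Lemma cone_metric_gt0 x y : U x -> 0 < pair (b x) y -> 0 < quad (a x) y y.
Proof.
move=> Ux By; apply: (ud_pos H Ux); apply: contraTneq By => ->.
by rewrite -(scale0r (0 : E)) pairZr mul0r ltxx.
Qed.

Lemma near_cone x y : U x -> 0 < pair (b x) y ->
  nbhs x [set z | U z /\ 0 < pair (b z) y].
Proof.
move=> Ux By; apply: filterI; first by apply: open_nbhs_nbhs; split=> //; exact: (ud_open H).
have cb : {for x, continuous (fun z => pair (b z) y)}.
  have : Cn 0 U (fun z => pair (b z) y).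
    apply: Cn_sum => [|i _]; first exact: (ud_open H).
    apply: Cn_mul; [exact: (ud_open H)| |exact: Cn_const].
    by apply: CnW; exact: Cn1_form.
  by move=> /Cn_cont; exact.
have := cb _ (open_nbhs_nbhs (conj (@open_gt R 0) By)).
exact.
Qed.

(** The derivative of log [energy] with respect to the position, in the direction
    [v]. *)
Definition dlog_pos x y v : R :=
  p * quad (xderive v a x) y y / quad (a x) y y
  + q * pair (xderive v b x) y / pair (b x) y.

Lemma dlog_posD x y u v : dlog_pos x y (u + v) = dlog_pos x y u + dlog_pos x y v.
Proof. by rewrite /dlog_pos !xderiveD quad_add pair_add; ring. Qed.

Lemma dlog_posZ x y c v : dlog_pos x y (c *: v) = c * dlog_pos x y v.
Proof. by rewrite /dlog_pos !xderiveZ quad_scale pair_scale; ring. Qed.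

Lemma delxE x y k : U x -> 0 < pair (b x) y ->
  delx k G x y = energy p q (a x) (b x) y * dlog_pos x y (delta_mx 0 k).
Proof.
move=> Ux By; apply: partialE.
apply: (@near_eq_is_derive _ _ _ (fun z => energy p q (a z) (b z) y)).
  by apply: filterS (near_cone Ux By) => z [Uz Bz]; rewrite GE.
apply: (@is_derive_powRM _ _ (fun z => quad (a z) y y) (fun z => pair (b z) y)) => //.
- exact: cone_metric_gt0.
- exact: is_derive_metric.
- exact: is_derive_form.
Qed.

Let coneb x := [set y | 0 < pair (b x) y].

Lemma open_cone x : open (coneb x).
Proof. exact: open_pair_gt0. Qed.

Lemma energy_coneE x : U x -> {in coneb x, G x =1 energy p q (a x) (b x)}.
Proof. by move=> Ux y; rewrite inE => By; rewrite GE. Qed.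

Lemma is_derive_energy_cone x y v : U x -> 0 < pair (b x) y ->
  is_derive y v (G x) (energy p q (a x) (b x) y * dlog_energy p q (a x) (b x) y v).
Proof.
move=> Ux By; apply: (@eq_open_is_derive _ _ (coneb x) (energy p q (a x) (b x))
  (G x) y v _ (@open_cone x) By).
  by move=> z /(energy_coneE Ux).
by apply: is_derive_energy => //; [exact: (ud_sym H)|exact: cone_metric_gt0].
Qed.

Lemma delyE x y k : U x -> 0 < pair (b x) y ->
  dely k G x y = energy p q (a x) (b x) y
    * dlog_energy p q (a x) (b x) y (delta_mx 0 k).
Proof. by move=> Ux By; apply: partialE; exact: is_derive_energy_cone. Qed.

Lemma dely2E x y i j : U x -> 0 < pair (b x) y ->
  dely j (dely i G) x y = energy p q (a x) (b x) y
    * hess_energy p q (a x) (b x) y (delta_mx 0 i) (delta_mx 0 j).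
Proof.
move=> Ux By; apply: partialE.
apply: (@eq_open_is_derive _ _ (coneb x) (fun y =>
  energy p q (a x) (b x) y * dlog_energy p q (a x) (b x) y (delta_mx 0 i))
  _ y _ _ (@open_cone x) By).
  by move=> z /[1!inE] Bz; rewrite delyE.
by apply: is_derive_denergy => //; [exact: (ud_sym H)|exact: cone_metric_gt0].
Qed.

Lemma Cn_energy_cone k x : U x -> Cn k (coneb x) (G x).
Proof.
move=> Ux; apply: (@eq_open_Cn _ _ _ _ (energy p q (a x) (b x))) (@open_cone x) _ _.
  by move=> y By; rewrite energy_coneE.
apply: Cn_energy => [|y By]; first exact: open_cone.
by split=> //; exact: cone_metric_gt0.
Qed.

Lemma Cn_dlog_pos k x v : U x -> Cn k (coneb x) (fun y => dlog_pos x y v).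
Proof.
move=> Ux; have oK := @open_cone x.
apply: Cn_add => //; apply: Cn_mul => //; try apply: Cn_mul => //; try exact: Cn_const.
- exact: Cn_quad.
- apply: Cn_inv => //; last exact: Cn_quad.
  by move=> y By; rewrite gt_eqF// cone_metric_gt0.
- exact: Cn_pair.
- apply: Cn_inv => //; last exact: Cn_pair.
  by move=> y By; rewrite gt_eqF.
Qed.

Lemma Cn_delx_cone k x i : U x -> Cn k (coneb x) (delx i G x).
Proof.
move=> Ux; apply: (@eq_open_Cn _ _ _ _ (fun y =>
  energy p q (a x) (b x) y * dlog_pos x y (delta_mx 0 i))) (@open_cone x) _ _.
  by move=> y; rewrite inE => By; rewrite delxE.
apply: Cn_mul; [exact: open_cone| |exact: Cn_dlog_pos].
apply: Cn_energy => [|y By]; first exact: open_cone.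
by split=> //; exact: cone_metric_gt0.
Qed.

Lemma dlog_energyD x y u v : dlog_energy p q (a x) (b x) y (u + v) =
  dlog_energy p q (a x) (b x) y u + dlog_energy p q (a x) (b x) y v.
Proof. by rewrite /dlog_energy quadDr pairDr; ring. Qed.

Lemma dlog_energyZ x y c v : dlog_energy p q (a x) (b x) y (c *: v) =
  c * dlog_energy p q (a x) (b x) y v.
Proof. by rewrite /dlog_energy quadZr pairZr; ring. Qed.

(** The complete lift acts on [energy] through the Lie derivatives of the metric
    and of the form. *)
Lemma complete_liftE V x y : U x -> 0 < pair (b x) y ->
  complete_lift V G x y = energy p q (a x) (b x) y *
    (p * quad (lie V a x) y y / quad (a x) y y
     + q * pair (mderive V b x + b x *m (jac V x)^T) y / pair (b x) y).
Proof.
move=> Ux By; pose e := energy p q (a x) (b x) y.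
have -> : complete_lift V G x y = e * dlog_pos x y (V x)
    + e * dlog_energy p q (a x) (b x) y (y *m jac V x).
  rewrite /complete_lift; congr (_ + _).
    rewrite -(sum_delta_linear (V x) (dlog_posD x y) (dlog_posZ x y)) mulr_sumr.
    by apply: eq_bigr => k _; rewrite delxE// mulrCA.
  rewrite -(sum_delta_linear (y *m jac V x) (dlog_energyD x y) (dlog_energyZ x y)).
  rewrite mulr_sumr exchange_big; apply: eq_bigr => j _ /=.
  rewrite mxE mulr_suml mulr_sumr; apply: eq_bigr => i _.
  by rewrite delyE// mxE /e; ring.
rewrite /dlog_pos /dlog_energy -!mderiveE /lie !quad_add pair_add.
have -> : quad (jac V x *m a x) y y = quad (a x) y (y *m jac V x).
  by rewrite (quadC _ _ (ud_sym H Ux)) !quadE !mulmxA.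
have -> : quad (a x *m (jac V x)^T) y y = quad (a x) y (y *m jac V x).
  by rewrite !quadE trmx_mul !mulmxA.
have -> : pair (b x *m (jac V x)^T) y = pair (b x) (y *m jac V x).
  by rewrite !pairE trmx_mul !mulmxA.
by rewrite /e; ring.
Qed.

End KropinaChart.

(** * The equations of the spray *)

Section Spray.
Context {R : realType} {n : nat}.
Local Notation E := 'rV[R]_n.
Implicit Types (x y z v w : E).
Context {U : set E} {a : E -> 'M[R]_n} {b W : E -> E}.
Hypothesis H : unit_dual U a b W.
Variables (m : R) (F : E -> E -> R).
Hypothesis FE : forall x y, U x -> 0 < pair (b x) y ->
  F x y = energy ((1 - m) / 2) m (a x) (b x) y.

Let p := 1 - m.
Let q := 2 * m.

Lemma sqr_kropinaE x y : U x -> 0 < pair (b x) y ->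
  sqr_fun F x y = energy p q (a x) (b x) y.
Proof.
move=> Ux By; rewrite /sqr_fun FE// /energy exprMn.
rewrite -!powR_mulrn ?powR_ge0// -!powRrM [m * _]mulrC.
by rewrite divfK ?pnatr_eq0.
Qed.

Lemma fund_tensor_form x y Z S : U x -> 0 < pair (b x) y ->
  quad (fund_tensor F x y) Z S =
  2^-1 * energy p q (a x) (b x) y * hess_energy p q (a x) (b x) y Z S.
Proof.
move=> Ux By; pose h := hess_energy p q (a x) (b x) y.
have hDl u v w : h (u + v) w = h u w + h v w.
  by rewrite /h /hess_energy /dlog_energy !(quadDl, quadDr, pairDr); ring.
have hZl c u w : h (c *: u) w = c * h u w.
  by rewrite /h /hess_energy /dlog_energy !(quadZl, quadZr, pairZr); ring.
have hDr u v w : h w (u + v) = h w u + h w v.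
  by rewrite /h /hess_energy /dlog_energy !(quadDl, quadDr, pairDr); ring.
have hZr c u w : h w (c *: u) = c * h w u.
  by rewrite /h /hess_energy /dlog_energy !(quadZl, quadZr, pairZr); ring.
rewrite -/(h Z S) -(sum_delta_linear Z (fun u v => hDl u v S) (fun c u => hZl c u S)).
rewrite mulr_sumr; apply: eq_bigr => k _.
rewrite -(sum_delta_linear S (fun u v => hDr u v _) (fun c u => hZr c u _)).
rewrite !mulr_sumr; apply: eq_bigr => l _.
by rewrite mxE (dely2E H sqr_kropinaE)// -/(h _ _); ring.
Qed.

Definition spray_rhs x y l : R :=
  \sum_k dely l (delx k (sqr_fun F)) x y * y 0 k - delx l (sqr_fun F) x y.

Definition spray_vector x y : E := \row_i spray F i x y.

Lemma fund_tensor_sym x y : U x -> 0 < pair (b x) y ->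
  (fund_tensor F x y)^T = fund_tensor F x y.
Proof.
move=> Ux By; apply/matrixP => i j; rewrite !mxE !(dely2E H sqr_kropinaE)//.
congr (_ * (_ * _)); rewrite /hess_energy.
by rewrite (quadC (delta_mx 0 i) _ (ud_sym H Ux)); ring.
Qed.

(** The spray coefficients are a quarter of the solution of a linear system with the
    matrix [fund_tensor]. *)
Lemma spray_solves x y Z : \det (fund_tensor F x y) != 0 ->
  quad (fund_tensor F x y) Z (spray_vector x y) =
  4^-1 * \sum_l Z 0 l * spray_rhs x y l.
Proof.
move=> d0; set g := fund_tensor F x y.
have ug : g \in unitmx by rewrite unitmxE unitfE.
pose r : E := \row_l spray_rhs x y l.
have -> : spray_vector x y = 4^-1 *: (invmx g *m r^T)^T.
  apply/rowP => i; rewrite !mxE; congr (_ * _).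
  by apply: eq_bigr => l _; rewrite !mxE.
rewrite quadZr quadE trmxK mulmxA mulmxK// -pairE.
by congr (_ * _); apply: eq_bigr => l _; rewrite mxE.
Qed.

(** The derivative of [dlog_pos x y v] with respect to y, in the direction Z. *)
Let ddlog x y v Z : R :=
  p * (2 * quad (xderive v a x) y Z / quad (a x) y y
       - quad (xderive v a x) y y * (2 * quad (a x) y Z) / quad (a x) y y ^+ 2)
  + q * (pair (xderive v b x) Z / pair (b x) y
       - pair (xderive v b x) y * pair (b x) Z / pair (b x) y ^+ 2).

Lemma spray_rhs_form x y (Z : E) : U x -> 0 < pair (b x) y ->
  \sum_l Z 0 l * spray_rhs x y l = energy p q (a x) (b x) y *
  (dlog_energy p q (a x) (b x) y Z *
     (p * quad (xderive y a x) y y / quad (a x) y y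
      + q * pair (xderive y b x) y / pair (b x) y)
   + p * (2 * quad (xderive y a x) y Z - quad (xderive Z a x) y y) / quad (a x) y y
   - 2 * p * quad (xderive y a x) y y * quad (a x) y Z / quad (a x) y y ^+ 2
   + q * (pair (xderive y b x) Z - pair (xderive Z b x) y) / pair (b x) y
   - q * pair (xderive y b x) y * pair (b x) Z / pair (b x) y ^+ 2).
Proof.
move=> Ux By; have A0 := cone_metric_gt0 H Ux By.
set e := energy p q (a x) (b x) y.
pose dp v := dlog_pos (a := a) (b := b) p q x y v.
have dlogE (k : 'I_n) : \sum_l Z 0 l * dely l (delx k (sqr_fun F)) x y =
    e * (dlog_energy p q (a x) (b x) y Z * dp (delta_mx 0 k) + ddlog x y (delta_mx 0 k) Z).
  pose ev : E := delta_mx 0 k.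
  have sa : (xderive ev a x)^T = xderive ev a x := symmetric_mderive H (fun=> ev) Ux.
  have D1 := is_derive_div (g := fun y => quad (a x) y y) (lt0r_neq0 A0)
    (is_derive_quad y Z sa) (is_derive_quad y Z (ud_sym H Ux)).
  have D2 := is_derive_div (g := pair (b x)) (lt0r_neq0 By)
    (is_derive_pair (xderive ev b x) y Z) (is_derive_pair (b x) y Z).
  have D3 := is_derive_mul (is_derive_energy p q Z (ud_sym H Ux) A0 By)
    (is_derive_add (is_derive_scale p D1) (is_derive_scale q D2)).
  have [_ <-] := C1_is_derive Z (@open_pair_gt0 _ _ (b x)) By
    (Cn_delx_cone H sqr_kropinaE 1 k Ux).
  have D4 := @eq_open_is_derive _ _ [set y | 0 < pair (b x) y] _
    (delx k (sqr_fun F) x) y Z _ (@open_pair_gt0 _ _ (b x)) By _ D3.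
  have [|_ ->] := D4; last by rewrite /e /dp /dlog_pos /ddlog /ev /xderive; ring.
  move=> z /[1!inE] Bz; rewrite (delxE H sqr_kropinaE)//.
  by rewrite /dlog_pos /ev; ring.
have dpD u v : dp (u + v) = dp u + dp v by exact: dlog_posD.
have dpZ c u : dp (c *: u) = c * dp u by exact: dlog_posZ.
pose f v := dlog_energy p q (a x) (b x) y Z * dp v + ddlog x y v Z.
have fD u v : f (u + v) = f u + f v.
  by rewrite /f dpD /ddlog !xderiveD !(quad_add, pair_add); ring.
have fZ c u : f (c *: u) = c * f u.
  by rewrite /f dpZ /ddlog !xderiveZ !(quad_scale, pair_scale); ring.
have -> : \sum_l Z 0 l * spray_rhs x y l = e * f y - e * dp Z.
  rewrite -(sum_delta_linear y fD fZ) -(sum_delta_linear Z dpD dpZ) !mulr_sumr.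
  under eq_bigr do rewrite mulrBr.
  rewrite sumrB; congr (_ - _); last first.
    by apply: eq_bigr => l _; rewrite (delxE H sqr_kropinaE)// mulrCA.
  under eq_bigr do rewrite mulr_sumr.
  rewrite exchange_big; apply: eq_bigr => k _ /=.
  rewrite mulrCA -dlogE mulr_sumr; apply: eq_bigr => l _.
  by rewrite mulrA mulrC.
by rewrite /f /dp /dlog_pos /ddlog /dlog_energy; ring.
Qed.

(** The linear system of the spray, contracted with a vector Z and divided by the
    energy. This form avoids inverting the fundamental tensor. *)
Lemma spray_equation x y (Z : E) : U x -> 0 < pair (b x) y ->
  \det (fund_tensor F x y) != 0 ->
  2 * hess_energy p q (a x) (b x) y Z (spray_vector x y) =
  dlog_energy p q (a x) (b x) y Z *
     (p * quad (xderive y a x) y y / quad (a x) y y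
      + q * pair (xderive y b x) y / pair (b x) y)
   + p * (2 * quad (xderive y a x) y Z - quad (xderive Z a x) y y) / quad (a x) y y
   - 2 * p * quad (xderive y a x) y y * quad (a x) y Z / quad (a x) y y ^+ 2
   + q * (pair (xderive y b x) Z - pair (xderive Z b x) y) / pair (b x) y
   - q * pair (xderive y b x) y * pair (b x) Z / pair (b x) y ^+ 2.
Proof.
move=> Ux By d0; have A0 := cone_metric_gt0 H Ux By.
have := spray_solves Z d0; rewrite fund_tensor_form// spray_rhs_form//.
set e := energy _ _ _ _ _; set h := hess_energy _ _ _ _ _ _ _; set r := (X in _ * (e * X)).
have e0 : e != 0 by rewrite /e /energy gt_eqF// mulr_gt0// powR_gt0.
rewrite -/r; clearbody e h r => Q; apply: (mulfI e0).
have -> : e * (2 * h) = 4 * (2^-1 * e * h) by field.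
by rewrite Q; field.
Qed.

End Spray.

(** * The dual field is Killing *)

Section Killing.
Context {R : realType} {n : nat}.
Local Notation E := 'rV[R]_n.
Implicit Types (x y z v w : E).
Context {U : set E} {a : E -> 'M[R]_n} {b W : E -> E}.
Hypothesis H : unit_dual U a b W.
Variables (m : R) (F : E -> E -> R).
Hypotheses (m0 : m != 0) (m1 : m != 1).
Hypothesis FE : forall x y, U x -> 0 < pair (b x) y ->
  F x y = energy ((1 - m) / 2) m (a x) (b x) y.

(** The directions in which the spray coefficients are meaningful. *)
Definition regular_directions x : set E :=
  [set y | 0 < pair (b x) y] `&` [set y | \det (fund_tensor F x y) != 0].

Lemma Cn_fund_tensor k x i j : U x ->
  Cn k [set y | 0 < pair (b x) y] (fun y => fund_tensor F x y i j).
Proof.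
move=> Ux; under [X in Cn _ _ X]eq_fun do rewrite mxE.
apply: Cn_mul; [exact: open_pair_gt0|exact: Cn_const|].
by do 2! apply: Cn_partial; exact: (Cn_energy_cone H (sqr_kropinaE FE) _ Ux).
Qed.

Lemma open_regular_directions x : U x -> open (regular_directions x).
Proof.
move=> Ux; have oK := @open_pair_gt0 _ _ (b x).
rewrite openE => y [By dy]; apply: filterI; first by apply: open_nbhs_nbhs; split.
have Cd := Cn_det oK (fun i j => Cn_fund_tensor 0 i j Ux).
have cd := Cn_cont Cd By.
exact: (cd _ (open_nbhs_nbhs (conj (@open_neq R 0) dy))).
Qed.

Lemma Cn_spray k x i : U x -> Cn k (regular_directions x) (spray F i x).
Proof.
move=> Ux; have oO := open_regular_directions Ux.
have sub : regular_directions x `<=` [set y | 0 < pair (b x) y] by move=> y [].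
apply: Cn_mul => //; first exact: Cn_const.
apply: Cn_sum => // l _; apply: Cn_mul => //.
  apply: Cn_invmx => // [y [_ dy]|i' j'].
    by rewrite unitmxE unitfE.
  by apply: Cn_subset sub _; exact: Cn_fund_tensor.
have CX j : Cn k.+1 (regular_directions x) (delx j (sqr_fun F) x).
  by apply: Cn_subset sub _; exact: (Cn_delx_cone H (sqr_kropinaE FE) _ _ Ux).
apply: Cn_add => //; last by apply: Cn_opp => //; exact: CnW.
apply: Cn_sum => // j _; apply: Cn_mul => //; last exact: Cn_coord.
exact: Cn_partial.
Qed.

Section Line.
Variables (x w : E).
Hypotheses (Ux : U x) (w0 : w != 0) (bw : pair (b x) w = 0).

Let k := quad (a x) w w.
Let y (t : R) : E := t *: W x + w.
Let da v := xderive v a x.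
Let db v := xderive v b x.

Lemma transversal_norm_gt0 : 0 < k. Proof. exact: (ud_pos H). Qed.

Lemma pair_line t : pair (b x) (y t) = t.
Proof. by rewrite /y pairDr pairZr (pair_dual H Ux) bw mulr1 addr0. Qed.

Lemma quad_line t v : quad (a x) (y t) v = t * pair (b x) v + quad (a x) w v.
Proof. by rewrite /y quadDl quadZl (quad_dual H). Qed.

Lemma quad_transversal_dual : quad (a x) w (W x) = 0.
Proof. by rewrite (quadC _ _ (ud_sym H Ux)) (quad_dual H). Qed.

Lemma quad_line_axis t : quad (a x) (y t) (W x) = t.
Proof. by rewrite quad_line (pair_dual H) ?mulr1// quad_transversal_dual addr0. Qed.

Lemma quad_line_transversal t : quad (a x) (y t) w = k.
Proof. by rewrite quad_line bw mulr0 add0r. Qed.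

Lemma quad_line_line t : quad (a x) (y t) (y t) = t ^+ 2 + k.
Proof. by rewrite quad_line pair_line (quadC _ _ (ud_sym H Ux)) quad_line_transversal. Qed.

Lemma hess_line_axis t S :
  hess_energy (1 - m) (2 * m) (a x) (b x) (y t) (W x) S =
  hess_axis m t k (pair (b x) S) (quad (a x) w S).
Proof.
rewrite /hess_energy /dlog_energy quad_line_axis quad_line_line pair_line.
by rewrite (pair_dual H)// quad_line (quad_dual H).
Qed.

Lemma hess_line_transversal t S :
  hess_energy (1 - m) (2 * m) (a x) (b x) (y t) w S =
  hess_transversal m t k (pair (b x) S) (quad (a x) w S).
Proof.
rewrite /hess_energy /dlog_energy quad_line_transversal quad_line_line pair_line.
by rewrite bw quad_line.
Qed.

Lemma line_denominators t : regular_axis (m * k) t ->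
  [/\ t != 0, t ^+ 2 + k != 0 & m * k - t ^+ 2 != 0].
Proof.
move=> [t0 D0]; split=> //; first by rewrite gt_eqF.
by rewrite gt_eqF// addr_gt0 ?exprn_gt0 ?transversal_norm_gt0.
Qed.

(** A vector in the kernel of the fundamental tensor has no component along W or w
    by the restricted system; on such vectors the tensor is a multiple of the
    metric. *)
Lemma regular_line t : regular_axis (m * k) t -> regular_directions x (y t).
Proof.
move=> /[dup] It [t0 _]; have [tn0 A0 D0] := line_denominators It.
have By : 0 < pair (b x) (y t) by rewrite pair_line.
split=> //=; apply/negP => /det0P[z z0 zg].
have hz Z : hess_energy (1 - m) (2 * m) (a x) (b x) (y t) Z z = 0.
  have : quad (fund_tensor F x (y t)) z Z = 0 by rewrite quadE zg mul0mx mxE.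
  rewrite (quadC _ _ (fund_tensor_sym H FE Ux By)) (fund_tensor_form H FE)//.
  move=> /eqP; rewrite mulf_eq0 => /orP[|/eqP //].
  rewrite mulf_eq0 invr_eq0 pnatr_eq0 /= gt_eqF// mulr_gt0// powR_gt0//.
  exact: (cone_metric_gt0 H Ux By).
have := hz (W x); have := hz w; rewrite hess_line_axis hess_line_transversal => e2 e1.
have [bz wz] := restricted_hess_inj tn0 A0 m1 D0 e1 e2.
have := hz z; rewrite /hess_energy /dlog_energy quad_line bz wz quad_line_line.
rewrite !(mulr0, mul0r, add0r, subr0) => /eqP.
rewrite !mulf_eq0 invr_eq0 (negbTE A0) orbF pnatr_eq0 /= subr_eq0 eq_sym (negbTE m1) /=.
by rewrite gt_eqF// (ud_pos H).
Qed.

(** Half of the Lie derivative of the metric along the dual field at (w, w), and half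
    of the exterior derivative of the form at (w, W). *)
Definition rho : R :=
  pair (db w) w - quad (da w) w (W x) + quad (da (W x)) w w / 2.
Definition sigma : R := (pair (db w) (W x) - pair (db (W x)) w) / 2.

(** Four times the v-component of the Riemannian spray at y t. *)
Let X v (t : R) : R := 2 * quad (da (y t)) (y t) v - quad (da v) (y t) (y t).

Lemma da_sym v : (da v)^T = da v.
Proof. exact: (symmetric_mderive H (fun=> v) Ux). Qed.

Lemma db_unit v : 2 * pair (db v) (W x) = quad (da v) (W x) (W x).
Proof. exact: (mderive_unit H (fun=> v) Ux). Qed.

Lemma da_line t : da (y t) = t *: da (W x) + da w.
Proof. by rewrite /da /y xderiveD xderiveZ. Qed.

Lemma db_line t : db (y t) = t *: db (W x) + db w.
Proof. by rewrite /db /y xderiveD xderiveZ. Qed.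

Lemma christoffel_line_poly v : exists c0 c1 c2, forall t,
  X v t = c0 + c1 * t + c2 * t ^+ 2.
Proof.
exists (2 * quad (da w) w v - quad (da v) w w).
exists (2 * quad (da (W x)) w v + 2 * quad (da w) (W x) v - 2 * quad (da v) w (W x)).
exists (2 * quad (da (W x)) (W x) v - quad (da v) (W x) (W x)).
move=> t; rewrite /X da_line /y !(quad_add, quad_scale, quadDl, quadZl).
by rewrite !(quadDr, quadZr) (quadC (W x) w (da_sym v)); ring.
Qed.

(** The spray equation contracted with W and w. The term of degree two of
    [pair (db (y t)) (y t)] is half of the one of [X (W x) t], because b has unit
    length. *)
Lemma spray_line t : regular_axis (m * k) t ->
  let S := spray_vector F x (y t) in
  pair (b x) S = X (W x) t / 4 + axis_coef m t k rho sigma /\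
  quad (a x) w S = X w t / 4 + transversal_coef m t k rho sigma.
Proof.
move=> It; have [tn0 A0 D0] := line_denominators It.
have [By dy] := regular_line It => S.
have e1 := spray_equation H FE (W x) Ux By dy.
have e2 := spray_equation H FE w Ux By dy.
have eA : quad (da (y t)) (y t) (y t) = t * X (W x) t + X w t.
  have e5 : quad (da (y t)) (y t) (y t) =
      t * quad (da (W x)) (y t) (y t) + quad (da w) (y t) (y t).
    by rewrite -quad_scale -quad_add -da_line.
  have e6 : quad (da (y t)) (y t) (y t) =
      t * quad (da (y t)) (y t) (W x) + quad (da (y t)) (y t) w.
    by rewrite -quadZr -quadDr.
  by rewrite /X; lra.
have uW := db_unit (W x); have uw := db_unit w.
have sW := da_sym (W x); have sw := da_sym w.
have eB : pair (db (y t)) (y t) = rho - 2 * t * sigma + X (W x) t / 2.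
  rewrite /rho /sigma /X da_line db_line /y.
  rewrite !(pair_add, pair_scale, pairDr, pairZr).
  rewrite !(quad_add, quad_scale, quadDl, quadZl, quadDr, quadZr).
  rewrite (quadC w (W x) sW).
  have -> : pair (db (W x)) (W x) = quad (da (W x)) (W x) (W x) / 2.
    by rewrite -uW; field.
  have -> : pair (db w) (W x) = quad (da w) (W x) (W x) / 2.
    by rewrite -uw; field.
  by field.
have e3 : pair (db (y t)) (W x) - pair (db (W x)) (y t) = 2 * sigma.
  by rewrite db_line /y /sigma pair_add pair_scale pairDr pairZr; field.
have e4 : pair (db (y t)) w - pair (db w) (y t) = - 2 * t * sigma.
  by rewrite db_line /y /sigma pair_add pair_scale pairDr pairZr; field.
move: e1; rewrite hess_line_axis -/(da _) -/(da _) -/(db _) -/(db _) eA eB e3.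
rewrite -/(X (W x) t) /dlog_energy quad_line_axis quad_line_line pair_line.
rewrite (pair_dual H Ux) => e1.
move: e2; rewrite hess_line_transversal -/(da _) -/(da _) -/(db _) -/(db _) eA eB e4.
rewrite -/(X w t) /dlog_energy quad_line_transversal quad_line_line pair_line bw => e2.
exact: (restricted_spray tn0 A0 m1 D0 e1 e2).
Qed.

(** The derivative of log F at y u in the direction v, multiplied by (u^2 + k) u. *)
Let lam (u : R) v : R :=
  (u ^+ 2 + m * k) * pair (b x) v + (1 - m) * u * quad (a x) w v.

Lemma dlog_line u v : regular_axis (m * k) u ->
  dlog_energy ((1 - m) / 2) m (a x) (b x) (y u) v = lam u v / ((u ^+ 2 + k) * u).
Proof.
move=> Iu; have [u0 A0 _] := line_denominators Iu.
rewrite /dlog_energy quad_line_line pair_line quad_line /lam; field.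
by rewrite A0 u0.
Qed.

Lemma lam_sum u v : \sum_i lam u (delta_mx 0 i) * v 0 i = lam u v.
Proof.
under eq_bigr do rewrite mulrC.
apply: sum_delta_linear => [v1 v2|c v1]; rewrite /lam.
  by rewrite pairDr quadDr; ring.
by rewrite pairZr quadZr; ring.
Qed.

Let vd := vderive (fun=> W x : E).

Lemma is_derive_vd g t : Cn 1 (regular_directions x) g -> regular_axis (m * k) t ->
  is_derive t 1 (fun t => g (y t)) (vd g (y t)).
Proof.
move=> Hg It; apply: (is_derive_line g w (W x) t (vd g (y t))).1.
exact: C1_is_derive (open_regular_directions Ux) (regular_line It) Hg.
Qed.

Lemma third_vd g z : Cn 3 (regular_directions x) g -> regular_directions x z ->
  vd (vd (vd g)) z = \sum_l \sum_k \sum_j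
    W x 0 l * W x 0 k * W x 0 j * partial l (partial k (partial j g)) z.
Proof.
move=> Hg Oz; have oO := open_regular_directions Ux.
have C1 c f i z' : Cn 1 (regular_directions x) f -> regular_directions x z' ->
    partial i (fun z => c * f z) z' = c * partial i f z'.
  move=> Hf Oz'; apply: partialE; apply: is_derive_scale.
  exact: Cn_derivable Hf Oz'.
have Cc d c f : Cn d (regular_directions x) f -> Cn d (regular_directions x) (fun z => c * f z).
  by move=> Hf; apply: Cn_mul => //; exact: Cn_const.
have E2 : {in regular_directions x, vd (vd g) =1
    fun z => \sum_k \sum_j W x 0 k * W x 0 j * partial k (partial j g) z}.
  move=> z' /[1!inE] Oz'; apply: eq_bigr => k' _.
  rewrite (partial_sum _ _ Oz'); last first.
    by move=> j _; apply: Cc; apply: CnW; exact: Cn_partial.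
  rewrite mulr_sumr; apply: eq_bigr => j _.
  by rewrite (C1 _ (partial j g))//; [ring|apply: CnW; exact: Cn_partial].
rewrite /vd (eq_open_vderive _ oO Oz E2) /vderive; apply: eq_bigr => l _.
have CS k' : Cn 1 (regular_directions x)
    (fun z => \sum_j W x 0 k' * W x 0 j * partial k' (partial j g) z).
  by apply: Cn_sum => // j _; apply: Cc; do 2! apply: Cn_partial.
rewrite (partial_sum _ _ Oz); last by move=> k' _; exact: CS.
rewrite mulr_sumr; apply: eq_bigr => k' _.
rewrite (partial_sum _ _ Oz); last first.
  by move=> j _; apply: Cc; do 2! apply: Cn_partial.
rewrite mulr_sumr; apply: eq_bigr => j _.
by rewrite (C1 _ (partial k' (partial j g)))//; [ring|do 2! apply: Cn_partial].
Qed.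

(** Contracted three times with W, the Landsberg condition says that the third
    derivative along the line of the [lam u]-component of the spray vanishes at u. *)
Lemma landsberg_line :
  (forall z, regular_directions x z ->
    forall j k l, landsberg_curvature F j k l x z = 0) ->
  rho = 0 /\ sigma = 0.
Proof.
move=> hL; apply: (landsberg_axis m0 m1 transversal_norm_gt0) => u Iu /=.
have p0 : 1 - m != 0 by rewrite subr_eq0 eq_sym.
have [[By _] Oy] := (regular_line Iu, regular_line Iu).
have [u0 A0 D0] := line_denominators Iu.
have CS d i : Cn d (regular_directions x) (spray F i x) by exact: Cn_spray.
have contracted j k' l : \sum_i lam u (delta_mx 0 i) *
    partial l (partial k' (partial j (spray F i x))) (y u) = 0.
  have := hL _ Oy j k' l; rewrite /landsberg_curvature => /eqP.
  have F0 : F x (y u) != 0.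
    rewrite FE// gt_eqF// mulr_gt0// powR_gt0//.
    exact: (cone_metric_gt0 H Ux By).
  rewrite mulf_eq0 mulf_eq0 oppr_eq0 invr_eq0 pnatr_eq0 (negbTE F0) /= => /eqP e.
  apply: (mulfI F0); apply: (mulIf (_ : ((u ^+ 2 + k) * u)^-1 != 0)).
    by rewrite invr_neq0// mulf_neq0.
  rewrite mulr0 mul0r -[RHS]e mulr_sumr mulr_suml; apply: eq_bigr => i _.
  by rewrite (delyE H FE)// -FE// dlog_line// /dely; ring.
have [x0 [x1 [x2 X1E]]] := christoffel_line_poly (W x).
have [y0 [y1 [y2 X2E]]] := christoffel_line_poly w.
pose f (D : (E -> R) -> E -> R) t := \sum_i lam u (delta_mx 0 i) * D (spray F i x) (y t).
have df (D : (E -> R) -> E -> R) t : (forall i, Cn 1 (regular_directions x) (D (spray F i x))) ->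
    regular_axis (m * k) t -> is_derive t 1 (f D) (f (fun g => vd (D g)) t).
  move=> CD It; apply: (@is_derive_bigsum R R^o) => i _; apply: is_derive_scale.
  exact: is_derive_vd.
have oO := open_regular_directions Ux.
have Cvd d g : Cn d.+1 (regular_directions x) g -> Cn d (regular_directions x) (vd g).
  by move=> Hg; apply: Cn_vderive => // i j; exact: Cn_const.
have h0 t : regular_axis (m * k) t ->
    is_derive t 1 (f id) (f vd t) by apply: df => i; exact: CS.
have h1 t : regular_axis (m * k) t ->
    is_derive t 1 (f vd) (f (fun g => vd (vd g)) t).
  by apply: df => i; apply: Cvd; exact: CS.
have h2 t : regular_axis (m * k) t ->
    is_derive t 1 (f (fun g => vd (vd g))) (f (fun g => vd (vd (vd g))) t).
  by apply: (df (fun g => vd (vd g))) => i; exact: Cvd (Cvd _ _ (CS _ i)).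
have := @third_derivative_fraction R (m * k) (f id) (f vd) (f (fun g => vd (vd g)))
  (f (fun g => vd (vd (vd g))))
  ((u ^+ 2 + m * k) * (x0 / 4 + m / 2 * rho)
   + (1 - m) * u * (y0 / 4 - m / (1 - m) * sigma * (3 * k)))
  ((u ^+ 2 + m * k) * (x1 / 4) + (1 - m) * u * (y1 / 4))
  ((u ^+ 2 + m * k) * (x2 / 4) + (1 - m) * u * (y2 / 4 - m / (1 - m) * sigma))
  _ _ h0 h1 h2 _ u Iu.
set d0 := (X in 24 * X * u); set d1 := (X in 48 * X * u ^+ 2).
move=> /(_ d0 d1) <-; last first.
  move=> t It; have [t0 At Dt] := line_denominators It.
  have [e1 e2] := spray_line It.
  transitivity (lam u (spray_vector F x (y t))).
    by rewrite -lam_sum; apply: eq_bigr => i _; rewrite mxE.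
  rewrite /lam e1 e2 X1E X2E /axis_coef /transversal_coef /d0 /d1; field.
  by rewrite p0 Dt.
rewrite (_ : f _ u = 0) ?mul0r//.
rewrite /f; under eq_bigr => i _ do rewrite (third_vd (CS 3%N i) Oy) mulr_sumr.
rewrite exchange_big big1// => l _; under eq_bigr do rewrite mulr_sumr.
rewrite exchange_big big1// => k' _; under eq_bigr do rewrite mulr_sumr.
rewrite exchange_big big1// => j _.
transitivity (W x 0 l * W x 0 k' * W x 0 j * \sum_i lam u (delta_mx 0 i) *
    partial l (partial k' (partial j (spray F i x))) (y u)).
  by rewrite mulr_sumr; apply: eq_bigr => i _; ring.
by rewrite contracted mulr0.
Qed.

(** Contracting the Douglas condition with [b] and with the covector dual to [w]
    shows that k b(G) - t a(w, G) is a polynomial in t. *)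
Lemma douglas_line : m != -1 ->
  (forall j l : 'I_n, exists T : 'I_n -> 'I_n -> 'I_n -> R,
    forall z, regular_directions x z ->
      spray F j x z * z 0 l - spray F l x z * z 0 j =
      \sum_p \sum_q \sum_r T p q r * z 0 p * z 0 q * z 0 r) ->
  rho = 0 /\ sigma = 0.
Proof.
move=> mN1 hD.
have hP jl : exists P : {poly R}, forall t, regular_axis (m * k) t ->
    spray F jl.1 x (y t) * y t 0 jl.2 - spray F jl.2 x (y t) * y t 0 jl.1 = P.[t].
  have [T HT] := hD jl.1 jl.2.
  pose Y i : {poly R} := W x 0 i *: 'X + (w 0 i)%:P.
  have YE i t : (Y i).[t] = y t 0 i by rewrite /Y !hornerE !mxE mulrC.
  exists (\sum_p \sum_q \sum_r T p q r *: (Y p * Y q * Y r)) => t It.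
  rewrite HT; last exact: regular_line.
  rewrite horner_sum; apply: eq_bigr => i1 _; rewrite horner_sum.
  apply: eq_bigr => i2 _; rewrite horner_sum; apply: eq_bigr => i3 _.
  by rewrite hornerZ !hornerM !YE; ring.
have [P HP] := choice hP.
have [x0 [x1 [x2 X1E]]] := christoffel_line_poly (W x).
have [y0 [y1 [y2 X2E]]] := christoffel_line_poly w.
pose om : E := w *m a x.
pose Q : {poly R} := \sum_j \sum_l (b x 0 j * om 0 l) *: P (j, l).
pose P1 : {poly R} := x0%:P + x1 *: 'X + x2 *: 'X^2.
pose P2 : {poly R} := y0%:P + y1 *: 'X + y2 *: 'X^2.
apply: (@douglas_axis _ m k _ _ (Q - (k / 4) *: P1 + 4^-1 *: ('X * P2)) m0 m1 mN1
  transversal_norm_gt0) => t It.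
have [e1 e2] := spray_line It.
have QE : Q.[t] = k * pair (b x) (spray_vector F x (y t))
    - t * quad (a x) w (spray_vector F x (y t)).
  set S := spray_vector F x (y t).
  transitivity (pair (b x) S * pair om (y t) - pair (b x) (y t) * pair om S).
    rewrite /Q /pair !big_distrlr /= -sumrB horner_sum; apply: eq_bigr => j _.
    rewrite -sumrB horner_sum; apply: eq_bigr => l _.
    by rewrite hornerZ -HP//= !mxE; ring.
  rewrite /om !pair_mulmx pair_line (quadC _ (y t) (ud_sym H Ux)).
  by rewrite quad_line_transversal; ring.
have P1E : P1.[t] = X (W x) t by rewrite X1E /P1 !hornerE.
have P2E : P2.[t] = X w t by rewrite X2E /P2 !hornerE.
rewrite [in RHS]hornerD [in RHS]hornerD hornerN.
rewrite !hornerZ hornerM hornerX P1E P2E QE e1 e2.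
by field.
Qed.

End Line.

Lemma lie_dual_form x y z : U x ->
  quad (lie W a x) y z = quad (xderive (W x) a x) y z
    + (pair (xderive y b x) z - quad (xderive y a x) (W x) z)
    + (pair (xderive z b x) y - quad (xderive z a x) (W x) y).
Proof.
move=> Ux.
have jacE v v' : quad (a x) (v *m jac W x) v' =
    pair (xderive v b x) v' - quad (xderive v a x) (W x) v'.
  have -> : v *m jac W x = xderive v W x.
    by apply/rowP => j; rewrite !mxE; apply: eq_bigr => i _; rewrite mxE.
  by rewrite (mderive_dual H (fun=> v) v' Ux); ring.
rewrite -!jacE /lie !quad_add mderiveE; congr (_ + _ + _).
  by rewrite !quadE !mulmxA.
by rewrite (quadC _ y (ud_sym H Ux)) !quadE trmx_mul !mulmxA.
Qed.

(** Half of the Lie derivative of the metric along W takes the values 0 on (W, W),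
    - sigma on (W, w) and rho on (w, w). *)
Lemma dual_killing x : U x ->
  (forall w, w != 0 -> pair (b x) w = 0 -> rho x w = 0 /\ sigma x w = 0) ->
  lie W a x = 0.
Proof.
move=> Ux h; have sl : (lie W a x)^T = lie W a x.
  rewrite /lie !linearD /= !trmx_mul trmxK (ud_sym H Ux) (symmetric_mderive H _ Ux).
  by rewrite -addrA [X in _ + X]addrC addrA.
have lWW : quad (lie W a x) (W x) (W x) = 0.
  have := mderive_unit H (fun=> W x) Ux.
  by rewrite lie_dual_form// /xderive; lra.
apply: (quad_eq0 sl) => v.
have [u [w [-> bw]]] := transversal_decomposition H v Ux.
rewrite !(quadDl, quadDr, quadZl, quadZr) lWW (quadC w _ sl).
have [->|w0] := eqVneq w 0.
  by rewrite -(scale0r (0 : E)) !(quadZr, quadZl); ring.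
have [r0 s0] := h w w0 bw.
have -> : quad (lie W a x) (W x) w = 0.
  have := mderive_unit H (fun=> w) Ux; move: s0; rewrite /sigma lie_dual_form//.
  by rewrite /xderive; lra.
have -> : quad (lie W a x) w w = 0.
  have sw : (xderive w a x)^T = xderive w a x := symmetric_mderive H (fun=> w) Ux.
  by move: r0; rewrite /rho lie_dual_form// (quadC w (W x) sw); lra.
by ring.
Qed.

End Killing.

(** * Conformal fields *)

Section ConformalForms.
Context {R : realType} {n : nat}.
Local Notation E := 'rV[R]_n.
Implicit Types (x y z v w : E).
Context {U : set E} {a : E -> 'M[R]_n} {b W : E -> E}.
Hypothesis H : unit_dual U a b W.
Variables (m : R) (F : E -> E -> R).
Hypotheses (m0 : m != 0) (m1 : m != 1).
Hypothesis FE : forall x y, U x -> 0 < pair (b x) y ->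
  F x y = energy ((1 - m) / 2) m (a x) (b x) y.

Lemma lie_dual_unit V x : U x ->
  quad (lie V a x) (W x) (W x) =
  2 * pair (mderive V b x + b x *m (jac V x)^T) (W x).
Proof.
move=> Ux; rewrite /lie !quad_add pair_add mulrDr (mderive_unit H V Ux) -addrA.
congr (_ + _).
have -> : quad (jac V x *m a x) (W x) (W x) = quad (a x) (W x) (W x *m jac V x).
  by rewrite (quadC _ _ (ud_sym H Ux)) !quadE !mulmxA.
have -> : quad (a x *m (jac V x)^T) (W x) (W x) = quad (a x) (W x) (W x *m jac V x).
  by rewrite !quadE trmx_mul !mulmxA.
have -> : pair (b x *m (jac V x)^T) (W x) = quad (a x) (W x) (W x *m jac V x).
  by rewrite (quad_dual H)// !pairE trmx_mul !mulmxA.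
by ring.
Qed.

(** Cleared of denominators, the conformality equation on the line t W + w is a
    cubic polynomial identity in t. Its coefficients give the values of both Lie
    derivatives on W and w, once [lie_dual_unit] has related those on W. *)
Lemma conformal_forms V x (c : R) : U x ->
  (forall y, 0 < pair (b x) y -> complete_lift V F x y = 2 * c * F x y) ->
  lie V a x = (4 * c) *: a x /\
  mderive V b x + b x *m (jac V x)^T = (2 * c) *: b x.
Proof.
move=> Ux hV; set S := lie V a x; set T := mderive V b x + _.
have m1' : 1 - m != 0 by rewrite subr_eq0 eq_sym.
have key y : 0 < pair (b x) y ->
    (1 - m) / 2 * quad S y y * pair (b x) y + m * pair T y * quad (a x) y y =
    2 * c * quad (a x) y y * pair (b x) y.
  move=> By; have A0 := cone_metric_gt0 H Ux By.
  have := hV y By; rewrite (complete_liftE H FE)// FE// -/S -/T.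
  set e := energy _ _ _ _ _.
  have e0 : e != 0 by rewrite gt_eqF// mulr_gt0// powR_gt0.
  rewrite [RHS]mulrC => /(mulfI e0) <-.
  by field; rewrite !gt_eqF.
have SW : quad S (W x) (W x) = 2 * pair T (W x) by exact: lie_dual_unit.
have bW := pair_dual H Ux; have aW := ud_unit H Ux.
have TW : pair T (W x) = 2 * c.
  by have := key (W x); rewrite bW ltr01 SW aW => /(_ isT); lra.
have sS : S^T = S.
  rewrite /S /lie !linearD /= !trmx_mul trmxK (ud_sym H Ux) (symmetric_mderive H _ Ux).
  by rewrite -addrA [X in _ + X]addrC addrA.
have trans w : pair (b x) w = 0 ->
    [/\ pair T w = 0, quad S (W x) w = 0 & quad S w w = 4 * c * quad (a x) w w].
  move=> bw; have [->|w0] := eqVneq w 0.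
    rewrite -(scale0r (0 : E)) !(quadZr, quadZl, pairZr) !mul0r.
    by split=> //; ring.
  have k0 := ud_pos H Ux w0.
  have line t : 0 < t -> ((1 - m) * quad S (W x) w + m * pair T w) * t ^+ 2
      + ((1 - m) / 2 * quad S w w - 2 * c * (1 - m) * quad (a x) w w) * t
      + m * pair T w * quad (a x) w w = 0.
    move=> t0; have := key (t *: W x + w).
    have -> : pair (b x) (t *: W x + w) = t by rewrite pairDr pairZr bW bw; ring.
    rewrite t0 => /(_ isT).
    rewrite !(quadDl, quadDr, quadZl, quadZr, pairDr, pairZr) (quadC w (W x) sS).
    rewrite (quadC w (W x) (ud_sym H Ux)) (quad_dual H w Ux) bw aW SW TW => e.
    lra.
  have l1 := line 1 ltr01; have l2 := line 2 (ltr0Sn _ 1); have l3 := line 3 (ltr0Sn _ 2).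
  have T0 : m * pair T w * quad (a x) w w = 0 by lra.
  have Tw : pair T w = 0.
    by move/eqP: T0; rewrite !mulf_eq0 (negbTE m0) (gt_eqF k0) orbF => /eqP.
  have Sw : (1 - m) * quad S (W x) w = 0 by rewrite Tw in l1 l2 l3; lra.
  split=> //.
    by move/eqP: Sw; rewrite mulf_eq0 (negbTE m1') => /eqP.
  apply: (mulfI m1'); rewrite Tw in l1 l2 l3; lra.
split.
  apply/eqP; rewrite -subr_eq0; apply/eqP; apply: quad_eq0 => [|y].
    by rewrite linearB linearZ /= sS (ud_sym H Ux).
  have [u [w [-> bw]]] := transversal_decomposition H y Ux.
  have [_ Sw Sww] := trans w bw.
  rewrite -scaleN1r quad_add !quad_scale.
  rewrite !(quadDl, quadDr, quadZl, quadZr) (quadC w _ sS) Sw SW TW Sww aW.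
  rewrite (quadC w _ (ud_sym H Ux)) (quad_dual H w Ux) bw.
  by ring.
apply/eqP; rewrite -subr_eq0; apply/eqP; apply: pair_eq0 => y.
have [u [w [-> bw]]] := transversal_decomposition H y Ux.
have [Tw _ _] := trans w bw.
rewrite -scaleN1r pair_add !pair_scale !(pairDr, pairZr) Tw TW bW bw.
by ring.
Qed.

(** The factor is half of the W-component of the Lie derivative of the form. *)
Lemma conformal_factor_C1 V (c : E -> R) : mCn 2 U V ->
  (forall x, U x ->
    mderive V b x + b x *m (jac V x)^T = (2 * c x) *: b x) -> Cn 1 U c.
Proof.
move=> HV hc; have oU := ud_open H.
have Cb : mCn 2 U b by apply: mCnW; exact: (ud_form H).
have CT : mCn 1 U (fun x => mderive V b x + b x *m (jac V x)^T).
  apply: mCn_add => //; first by apply: mCn_derive => //; exact: mCnW.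
  apply: mCn_mul => //; first exact: mCnW.
  by apply: mCn_tr; exact: Cn_jac.
apply: (@eq_open_Cn _ _ _ _ (fun x =>
  2^-1 * pair (mderive V b x + b x *m (jac V x)^T) (W x))) => //.
  move=> x /[1!inE] Ux; rewrite hc// pair_scale (pair_dual H)//.
  by field.
apply: Cn_mul => //; first exact: Cn_const.
apply: Cn_sum => // j _; apply: (Cn_mul oU (CT 0 j)).
by do 2! apply: CnW; exact: (ud_field H).
Qed.

Lemma conformal_factor_locally_constant V (c : E -> R) : (2 <= n)%N ->
  mCn 2 U V ->
  (forall x, U x -> forall y, 0 < pair (b x) y ->
    complete_lift V F x y = 2 * c x * F x y) ->
  (forall x, U x -> forall z, regular_directions (b := b) F x z ->
     forall j k l, landsberg_curvature F j k l x z = 0) \/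
  ((forall x, U x -> forall j l : 'I_n, exists T : 'I_n -> 'I_n -> 'I_n -> R,
    forall z, regular_directions (b := b) F x z ->
      spray F j x z * z 0 l - spray F l x z * z 0 j =
      \sum_p \sum_q \sum_r T p q r * z 0 p * z 0 q * z 0 r) /\ m != -1) ->
  Cn 1 U c /\ forall x, U x -> forall i, partial i c x = 0.
Proof.
move=> n2 HV hV hF.
have forms x (Ux : U x) := conformal_forms Ux (hV x Ux).
have Hc : Cn 1 U c by apply: (conformal_factor_C1 HV) => x /forms[].
split=> // x Ux i.
apply: (conformal_factor_gradient H i n2 Ux HV Hc) => z Uz.
- apply: (dual_killing H Uz) => w w0 bw.
  case: hF => [hL|[hD mN1]].
    exact: (landsberg_line H m0 m1 FE Uz w0 bw (hL z Uz)).
  exact: (douglas_line H m0 m1 FE Uz w0 bw mN1 (hD z Uz)).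
- by have [] := forms z Uz.
- by have [LV Lb] := forms z Uz; exact: (bracket_dual H Uz HV LV Lb).
Qed.

End ConformalForms.

Lemma constant_on_ball (R : realType) (n : nat) (U : set 'rV[R]_n) (c : 'rV[R]_n -> R)
    (x z : 'rV[R]_n) (r : R) : open U -> ball x r `<=` U -> Cn 1 U c ->
  (forall x, U x -> forall i, partial i c x = 0) -> ball x r z -> c z = c x.
Proof.
move=> oU bU Hc c0 bz.
have inU (s : R) : `|s| <= `|1 : R| -> U (s *: (z - x) + x).
  move=> s1; apply: bU; move: bz; rewrite -!ball_normE /= => bz.
  rewrite distrC addrK normrZ (le_lt_trans _ bz)// [leRHS]distrC.
  by rewrite ler_piMl// (le_trans s1)// normr1.
have D (s : R) : `|s| <= `|1 : R| -> is_derive (s *: (z - x) + x) (z - x) c 0.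
  move=> s1; have := C1_is_derive (z - x) oU (inU s s1) Hc.
  by rewrite big1// => i _; rewrite c0 ?mulr0//; exact: inU.
have [s s1] := @mean_value_line _ _ c x (z - x) 1 (fun s s1 => @ex_derive _ _ _ _ _ _ _ (D s s1)).
have [_ ->] := D s s1.
by rewrite scale1r subrK mulr0 => /subr0_eq.
Qed.

(** * Normalisation of the metric *)

Section Normalisation.
Context {R : realType} {n : nat}.
Local Notation E := 'rV[R]_n.
Implicit Types (x y z v w : E).
Context {U : set E} {a : E -> 'M[R]_n} {b : E -> E} {m : R}.
Hypotheses (oU : open U) (Ca : mCn 3 U a) (Cb : mCn 3 U b).
Hypothesis sa : forall x, U x -> (a x)^T = a x.
Hypothesis pa : forall x, U x -> forall y, y != 0 -> 0 < quad (a x) y y.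
Hypothesis b0 : forall x, U x -> b x != 0.

(** The exponents are chosen such that the metric alpha^(1-m) beta^m is unchanged
    and the form gets unit length. *)
Definition sharp x : E := b x *m invmx (a x).
Definition norm2 x : R := pair (b x) (sharp x).
Definition unit_metric x : 'M[R]_n := norm2 x `^ m *: a x.
Definition unit_form x : E := norm2 x `^ ((m - 1) / 2) *: b x.
Definition unit_field x : E := norm2 x `^ (- ((m + 1) / 2)) *: sharp x.

Lemma sharpK x : U x -> sharp x *m a x = b x.
Proof. by move=> Ux; rewrite mulmxKV// posdef_unitmx//; exact: pa. Qed.

Lemma quad_sharp x y : U x -> quad (a x) (sharp x) y = pair (b x) y.
Proof. by move=> Ux; rewrite -pair_mulmx sharpK. Qed.

Lemma norm2_gt0 x : U x -> 0 < norm2 x.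
Proof.
move=> Ux; rewrite /norm2 -quad_sharp//; apply: pa => //.
by apply: contraNneq (b0 Ux) => s0; rewrite -(sharpK Ux) s0 mul0mx.
Qed.

Lemma unit_dual_normalisation : unit_dual U unit_metric unit_form unit_field.
Proof.
have Ci : mCn 3 U (fun x => invmx (a x)).
  exact: (Cn_invmx oU (fun x Ux => posdef_unitmx (pa Ux)) Ca).
have Cs : mCn 3 U sharp := mCn_mul oU Cb Ci.
have CN : Cn 3 U norm2.
  by apply: (Cn_sum _ oU) => j _; exact: (Cn_mul oU (Cb 0 j) (Cs 0 j)).
have CP e : Cn 3 U (fun x => norm2 x `^ e) := Cn_powR e oU (fun x => @norm2_gt0 x) CN.
have CZ m1 m2 e (A : E -> 'M[R]_(m1, m2)) : mCn 3 U A ->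
    mCn 3 U (fun x => norm2 x `^ e *: A x).
  by move=> CA i j; under [X in Cn _ _ X]eq_fun do rewrite mxE; exact: (Cn_mul oU (CP e) (CA i j)).
split.
- exact: oU.
- exact: (CZ _ _ m a Ca).
- exact: (CZ _ _ ((m - 1) / 2) b Cb).
- exact: (CZ _ _ (- ((m + 1) / 2)) sharp Cs).
- by move=> x Ux; rewrite /unit_metric linearZ /= sa.
- move=> x Ux y y0; rewrite quad_scale mulr_gt0 ?powR_gt0 ?norm2_gt0//.
  exact: pa.
- move=> x Ux; have N0 := norm2_gt0 Ux.
  rewrite /unit_field /unit_metric /unit_form -scalemxAr -scalemxAl sharpK//.
  rewrite scalerA -powRD ?(gt_eqF N0) ?implybT//.
  by congr (_ `^ _ *: _); field.
move=> x Ux; have N0 := norm2_gt0 Ux.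
rewrite /unit_metric /unit_field quad_scale quadZl quadZr quad_sharp// -/(norm2 x).
rewrite -[in X in _ * (_ * (_ * X))](powRr1 (ltW N0)).
rewrite -!powRD ?(gt_eqF N0) ?implybT//.
by rewrite (_ : _ + _ = 0) ?powRr0//; field.
Qed.

Lemma unit_form_gt0 x y : U x -> (0 < pair (unit_form x) y) = (0 < pair (b x) y).
Proof. by move=> Ux; rewrite pair_scale pmulr_rgt0// powR_gt0// norm2_gt0. Qed.

Lemma unit_energy x y : U x -> 0 < pair (b x) y ->
  Num.sqrt (quad (a x) y y) `^ (1 - m) * pair (b x) y `^ m =
  energy ((1 - m) / 2) m (unit_metric x) (unit_form x) y.
Proof.
move=> Ux By; have N0 := norm2_gt0 Ux.
have A0 : 0 < quad (a x) y y.
  by apply: pa => //; apply: contraTneq By => ->; rewrite -(scale0r (0 : E)) pairZr mul0r ltxx.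
rewrite /energy quad_scale pair_scale !powRM ?powR_ge0 ?(ltW A0) ?(ltW By)//.
rewrite -powR12_sqrt ?(ltW A0)// -!powRrM mulrACA -powRD ?(gt_eqF N0) ?implybT//.
rewrite (_ : m * _ + _ = 0) ?powRr0 ?mul1r; last by field.
by congr (_ `^ _ * _); field.
Qed.

End Normalisation.

(** * From charts to the manifold *)

Lemma locally_constant_connected (T : topologicalType) (A : Type) (c : T -> A) :
  connected [set: T] -> (forall p, \forall q \near p, c q = c p) ->
  forall p q, c p = c q.
Proof.
move=> cT lc p q; pose B := [set r | c r = c p].
have oB : open B.
  rewrite openE => r /= Br; near=> s; rewrite /B /=.
  by rewrite -Br; near: s; exact: lc.
have oCB : open (~` B).
  rewrite openE => r /= Br; near=> s; rewrite /B /= => Bs; apply: Br.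
  by rewrite /B /= -Bs; apply/esym; near: s; exact: lc.
have : B = setT.
  apply: cT; first by exists p.
    by exists B; rewrite ?setTI.
  by exists B; rewrite ?setTI// -[B]setCK; exact: open_closedC.
by move=> /seteqP[_ /(_ q I)].
Unshelve. all: by end_near. Qed.

Section Manifold.
Context {R : realType} {n : nat} {M : manifold R n}.
Local Notation E := 'rV[R]_n.

Lemma near_chart (i : chart M) (p : M) (A : set E) : chart_dom i p ->
  nbhs (chart_map i p) A -> \forall q \near p, chart_dom i q /\ A (chart_map i q).
Proof.
move=> ip Ap; have oD := chart_dom_open i.
have := @chart_map_continuous _ _ M i; rewrite continuous_open_subspace// => cD.
apply: filterI; first by apply: open_nbhs_nbhs; split.
by have := cD p; rewrite inE => /(_ ip); exact.
Qed.

Lemma kropina_factor_chart (hn : (2 <= n)%N) (a : riemannian_metric M) (b : one_form M)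
    (hb : nowhere_vanishing b) (m : R) (hm0 : m != 0) (hm1 : m != 1)
    (V : vector_field M) (c : M -> R)
    (hV : conformal_with_factor (kropina m a b) V c)
    (hF : landsberg (kropina m a b) \/ (douglas (kropina m a b) /\ m != -1))
    (i : chart M) : let f := fun x => c (chart_inv i x) in
  Cn 1 (chart_cod i) f /\ forall x, chart_cod i x -> forall j, partial j f x = 0.
Proof.
have oU : open (chart_cod i) := @chart_cod_open _ _ M i.
have Ca : mCn 3 (chart_cod i) (a i).
  by move=> k l; apply: smooth_on_Cn; exact: rm_smooth.
have Cb : mCn 3 (chart_cod i) (b i).
  by move=> k l; apply: smooth_on_Cn; rewrite ord1; exact: of_smooth.
have CV : mCn 2 (chart_cod i) (V i).
  by move=> k l; apply: smooth_on_Cn; rewrite ord1; exact: vf_smooth.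
have sa := @rm_sym _ _ _ a i; have pa := @rm_posdef _ _ _ a i.
have b0 x : chart_cod i x -> b i x != 0 by exact: hb.
have H := unit_dual_normalisation (m := m) oU Ca Cb sa pa b0.
have pos x y : chart_cod i x ->
    (0 < pair (@unit_form R n (a i) (b i) m x) y) = (0 < pair (b i x) y).
  exact: (unit_form_gt0 pa b0).
apply: (@conformal_factor_locally_constant _ _ _ _ _ _ H m (kropina m a b i) hm0 hm1 _ (V i)) => //.
- by move=> x y Ux; rewrite pos// => By; exact: (unit_energy pa b0).
- by move=> x Ux y; rewrite pos// => By; exact: hV.
case: hF => [hL|[hD mN1]]; [left|right; split=> //].
  move=> x Ux z [/=]; rewrite pos// => Bz dz j k l.
  by apply: hL => //; split.
move=> x Ux j l; have [T HT] := hD i x Ux j l; exists T => z [/=].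
by rewrite pos// => Bz dz; apply: HT; split.
Qed.

End Manifold.

Local Close Scope classical_set_scope.

Theorem theorem5p2 (R : realType) (n : nat) (hn : (2 <= n)%N)
    (M : manifold R n) (a : riemannian_metric M) (b : one_form M)
    (hb : nowhere_vanishing b) (m : R) (hm0 : m != 0) (hm1 : m != 1)
    (V : vector_field M) (hV : conformal (kropina m a b) V)
    (hF : (landsberg (kropina m a b) /\ (3 <= n)%N) \/
          (douglas (kropina m a b) /\ m != -1)) :
  homothetic (kropina m a b) V.
Proof.
have [c hc] := hV.
have hF' : landsberg (kropina m a b) \/ (douglas (kropina m a b) /\ m != -1).
  by case: hF => [[hL _]|hD]; [left|right].
have chartc := kropina_factor_chart hn hb hm0 hm1 hc hF'.
have lc (p : M) : \forall q \near p, c q = c p.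
  have [i ip] := chart_cover p; have [C1 C0] := chartc i.
  have Ux : chart_cod i (chart_map i p) by exists p.
  have oU : open (chart_cod i) := @chart_cod_open _ _ M i.
  have [r /= r0 bU] : nbhs_ball (chart_map i p) (chart_cod i).
    by apply/nbhs_ballP; apply: open_nbhs_nbhs; split.
  have := near_chart ip (nbhsx_ballx (chart_map i p) r r0).
  apply: filterS => q [iq bq].
  have := constant_on_ball oU bU C1 C0 bq.
  by rewrite !chart_mapK.
have cc := locally_constant_connected (@manifold_connected _ _ M) lc.
(* Without points there are no directions either, and any constant will do. *)
have [[p0 _]|noM] := pselect (exists p : M, True); last first.
  by exists 0 => i x [p _ _]; case: noM; exists p.
exists (c p0) => i x Ux y Cy.
by rewrite hc// (cc (chart_inv i x) p0).
Qed.
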